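(* Let $d\ge 2$, let $\mathbb{K}$ be an infinite field, and let $f\in\operatorname{Hom}(\mathbb{K}^{n_1}\times\cdots\times\mathbb{K}^{n_d},\mathbb{K})$ be multilinear. Then \[ \operatorname{AR}_{\mathbb{K}}(f)\le\operatorname{PR}_{\mathbb{K}}(f)\le(2^{d-1}-1)\operatorname{AR}_{\mathbb{K}}(f). \]
   Context: Partition rank: a nonzero multilinear $f$ has $\operatorname{PR}_{\mathbb{K}}(f)=1$ if there is a nonempty proper subset $A\subsetneq[d]$ and multilinear functions $g$ in the arguments $(x_i)_{i\in A}$ and $h$ in the arguments $(x_i)_{i\notin A}$ (over $\mathbb{K}$) with $f=gh$; in general $\operatorname{PR}_{\mathbb{K}}(f)$ is the least $r\ge0$ such that $f$ is a sum of $r$ multilinear functions of partition rank $1$. For an infinite field $\mathbb{K}$ and $S\subseteq\mathbb{K}^n$, $\overline{S}\subseteq\overline{\mathbb{K}}^n$ is the set of common zeros in $\overline{\mathbb{K}}^n$ of all polynomials in $\mathbb{K}[x_1,\dots,x_n]$ vanishing on $S$. The analytic rank is $\operatorname{AR}_{\mathbb{K}}(f)\coloneqq\operatorname{codim}\overline{Z_{F_f}(\mathbb{K})}$, where $Z_{F_f}(\mathbb{K})=\{(\mathsf{v}_1,\dots,\mathsf{v}_{d-1})\in\mathbb{K}^{n_1}\times\cdots\times\mathbb{K}^{n_{d-1}}: f(\mathsf{v}_1,\dots,\mathsf{v}_{d-1},\mathsf{w})=0\ \forall \mathsf{w}\in\mathbb{K}^{n_d}\}$ and codimension is in $\overline{\mathbb{K}}^{n_1+\cdots+n_{d-1}}$.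 *)

(* Defs.v *)
From HB Require Import structures.
From mathcomp Require Import all_boot all_algebra.
From mathcomp Require Import mpoly.

Set Implicit Arguments.
Unset Strict Implicit.
Unset Printing Implicit Defensive.

Import GRing.Theory.
Local Open Scope ring_scope.

(* A point of K^{n_1} x ... x K^{n_d} is a dependent family of vectors *)
(* x i : 'I_(n i) -> K  (i.e. x i is an element of K^{n_i}).           *)

Definition tensor (K : Type) (d : nat) (n : 'I_d -> nat) :=
  forall i : 'I_d, 'I_(n i) -> K.

Definition lin_in_block (K : fieldType) (d : nat) (n : 'I_d -> nat)
    (i : 'I_d) (g : tensor K n -> K) : Prop :=
  forall (a : K) (x y z : tensor K n),
    (forall j : 'I_d, j != i -> forall k, x j k = z j k /\ y j k = z j k) ->
    (forall k, z i k = a * x i k + y i k) ->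
    g z = a * g x + g y.

Definition multilinear_on (K : fieldType) (d : nat) (n : 'I_d -> nat)
    (A : {set 'I_d}) (g : tensor K n -> K) : Prop :=
  (forall x y : tensor K n,
      (forall i, i \in A -> forall k, x i k = y i k) -> g x = g y) /\
  (forall i, i \in A -> lin_in_block i g).

Definition multilinear (K : fieldType) (d : nat) (n : 'I_d -> nat)
    (g : tensor K n -> K) : Prop :=
  multilinear_on [set: 'I_d] g.

Definition pr_one (K : fieldType) (d : nat) (n : 'I_d -> nat)
    (f : tensor K n -> K) : Prop :=
  (exists x, f x != 0) /\
  exists (A : {set 'I_d}) (g h : tensor K n -> K),
    [/\ A != set0, A != [set: 'I_d],
        multilinear_on A g, multilinear_on (~: A) h &
        forall x, f x = g x * h x].

Definition pr_le (K : fieldType) (d : nat) (n : 'I_d -> nat)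
    (f : tensor K n -> K) (r : nat) : Prop :=
  exists gs : 'I_r -> tensor K n -> K,
    (forall k, pr_one (gs k)) /\ forall x, f x = \sum_(k < r) gs k x.

Definition is_PR (K : fieldType) (d : nat) (n : 'I_d -> nat)
    (f : tensor K n -> K) (r : nat) : Prop :=
  pr_le f r /\ forall r', pr_le f r' -> (r <= r')%N.

Definition zero_set (L : fieldType) (N : nat) (P : {mpoly L[N]} -> Prop)
    : ('I_N -> L) -> Prop :=
  fun v => forall p, P p -> p.@[v] = 0.

Definition zclosed (L : fieldType) (N : nat) (V : ('I_N -> L) -> Prop) : Prop :=
  exists P : {mpoly L[N]} -> Prop, forall v, V v <-> zero_set P v.

Definition subset_of (T : Type) (A B : T -> Prop) : Prop := forall v, A v -> B v.

Definition strict_subset_of (T : Type) (A B : T -> Prop) : Prop :=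
  subset_of A B /\ exists v, B v /\ ~ A v.

Definition zirreducible (L : fieldType) (N : nat) (V : ('I_N -> L) -> Prop) : Prop :=
  [/\ zclosed V, (exists v, V v) &
      forall V1 V2, zclosed V1 -> zclosed V2 ->
        subset_of V (fun v => V1 v \/ V2 v) ->
        subset_of V V1 \/ subset_of V V2].

Definition has_chain (L : fieldType) (N : nat) (W : ('I_N -> L) -> Prop)
    (m : nat) : Prop :=
  exists C : nat -> ('I_N -> L) -> Prop,
    (forall k, (k <= m)%N -> zirreducible (C k) /\ subset_of (C k) W) /\
    (forall k, (k < m)%N -> strict_subset_of (C k) (C k.+1)).

Definition dim_is (L : fieldType) (N : nat) (W : ('I_N -> L) -> Prop)
    (m : nat) : Prop :=
  has_chain W m /\ forall m', has_chain W m' -> (m' <= m)%N.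

Definition codim_is (L : fieldType) (N : nat) (W : ('I_N -> L) -> Prop)
    (c : nat) : Prop :=
  exists m, dim_is W m /\ c = (N - m)%N.

Definition kclosure (K L : fieldType) (iota : {rmorphism K -> L}) (N : nat)
    (S : ('I_N -> K) -> Prop) : ('I_N -> L) -> Prop :=
  zero_set (fun q : {mpoly L[N]} =>
    exists p : {mpoly K[N]},
      (forall v, S v -> p.@[v] = 0) /\ q = map_mpoly iota p).

Definition first_coords (d : nat) (n : 'I_d -> nat) : finType :=
  {p : {i : 'I_d & 'I_(n i)} | (val (tag p) < d.-1)%N}.

(* Z_{F_f}(K), with K^{n_1} x ... x K^{n_{d-1}} identified with K^N,
   N = #|first_coords n| = n_1 + ... + n_{d-1}, via enum_rank.
   v is in Z iff f(v, w) = 0 for every w in K^{n_d}, i.e. f vanishes at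
   every point u whose first d-1 arguments are given by v. *)
Definition ZF (K : fieldType) (d : nat) (n : 'I_d -> nat)
    (f : tensor K n -> K) : ('I_#|first_coords n| -> K) -> Prop :=
  fun v => forall u : tensor K n,
    (forall p : first_coords n,
        u (tag (val p)) (tagged (val p)) = v (enum_rank p)) ->
    f u = 0.

(* AR_K(f) = ar, computed in an algebraic closure L of K (via iota) *)
Definition is_AR (K L : fieldType) (iota : {rmorphism K -> L})
    (d : nat) (n : 'I_d -> nat) (f : tensor K n -> K) (ar : nat) : Prop :=
  codim_is (kclosure iota (ZF f)) ar.

(* Main.v *)
Require Import Defs.
From HB Require Import structures.
From mathcomp Require Import all_boot all_algebra.
From mathcomp Require Import mpoly.
From mathcomp Require Import boolp zify ring.
From mathcomp Require classical_sets.

(** Let [S] be the set of [K]-points [ZF f] and [N] the number of coordinates.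
    The dimension of its closure is the largest size of a set [J] of
    coordinates that is independent on [S], i.e. such that no nonzero
    polynomial in these coordinates vanishes on [S].

    [AR <= PR]: every rank one summand has a factor not involving the last
    argument.  On the common zeros of these factors, an equation is linear in the
    last block it involves; adding the blocks one at a time one gets fibrations
    in linear spaces, and loses at most one independent coordinate per equation.

    [PR <= (2^(d-1) - 1) AR]: choose a prime ideal [P] containing the ideal of
    [S], of the same dimension, and such that every generic condition modulo [P]
    is satisfied at a point of [S].  As [P] comes from [K]-points it is separable,
    whence [s = N - dim] polynomials [p_i] in [P] whose differentials span, modulo
    [P], the differentials of all elements of [P].  Differentiate the equations
    [f(., w) = 0] of [S] once in each of the first [d - 1] blocks, using at each
    step that the differential of an element of [P] is a combination of the
    [dp_i]: [f] becomes a sum, over [i < s] and over the nonempty sets [A] of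
    these blocks, of the products of the [A]-derivative of [p_i] by a function of
    the other blocks. *)

Set Implicit Arguments.
Unset Strict Implicit.
Unset Printing Implicit Defensive.

Import GRing.Theory.
Local Open Scope ring_scope.

(** * Prime ideals and elimination in one variable *)

Lemma exists_minimizer (T : Type) (Q : T -> Prop) (f : T -> nat) :
  (exists t, Q t) -> exists2 t, Q t & forall t', Q t' -> (f t <= f t')%N.
Proof.
case=> t0 Qt0; have [n] := ubnP (f t0); elim: n t0 Qt0 => // n IH t0 Qt0 lt_n.
case: (EM (exists2 t', Q t' & (f t' < f t0)%N)) => [[t' Qt' lt_t']|no].
  by apply: (IH t') => //; exact: leq_trans lt_t' _.
exists t0 => // t' Qt'; rewrite leqNgt; apply/negP => lt_t'; apply: no.
by exists t'.
Qed.

(** Ideals are [Prop]-valued predicates: the ones of interest are vanishing ideals and ideals given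
    by Zorn's lemma. *)
Record prime_ideal (R : nzRingType) (P : R -> Prop) : Prop := PrimeIdeal {
  prime_ideal0 : P 0;
  prime_idealD : forall p q, P p -> P q -> P (p + q);
  prime_idealM : forall a p, P p -> P (a * p);
  prime_ideal1 : ~ P 1;
  prime_idealP : forall p q, P (p * q) -> P p \/ P q }.

Section PrimeIdealTheory.
Variables (R : comNzRingType) (P : R -> Prop) (Pp : prime_ideal P).

Lemma prime_idealMr a p : P p -> P (p * a).
Proof. by move=> Hp; rewrite mulrC; apply: prime_idealM. Qed.

Lemma prime_idealN p : P p -> P (- p).
Proof. by move=> Hp; rewrite -mulN1r; apply: prime_idealM. Qed.

Lemma prime_idealB p q : P p -> P q -> P (p - q).
Proof. by move=> Hp Hq; apply: prime_idealD => //; apply: prime_idealN. Qed.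

Lemma prime_ideal_sum (I : Type) (r : seq I) (C : pred I) (F : I -> R) :
  (forall i, C i -> P (F i)) -> P (\sum_(i <- r | C i) F i).
Proof.
by move=> h; apply: big_ind => //; [apply: prime_ideal0 | apply: prime_idealD].
Qed.

Lemma nprime_idealM p q : ~ P p -> ~ P q -> ~ P (p * q).
Proof. by move=> Hp Hq /(prime_idealP Pp)[]. Qed.

Lemma nprime_idealX p n : ~ P p -> ~ P (p ^+ n).
Proof.
move=> Hp; elim: n => [|n IH]; first exact: prime_ideal1.
by rewrite exprS; apply: nprime_idealM.
Qed.

Lemma prime_ideal_cancel a p : ~ P a -> P (a * p) -> P p.
Proof. by move=> Ha /(prime_idealP Pp)[]. Qed.

Lemma nprime_ideal_prod (I : Type) (r : seq I) (C : pred I) (F : I -> R) :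
  (forall i, C i -> ~ P (F i)) -> ~ P (\prod_(i <- r | C i) F i).
Proof.
move=> h; apply: (big_ind (fun p => ~ P p)) => //; first exact: prime_ideal1.
exact: nprime_idealM.
Qed.

End PrimeIdealTheory.

(** Powers of the leading coefficient of [mu] replace division by it, so that quotient and remainder
    keep their coefficients in [S]. The bound on [size Q] serves to show that a quotient of a
    minimal polynomial is shorter than it. *)
Lemma pseudo_division (R : comNzRingType) (S : subringClosed R)
    (G mu : {poly R}) :
  G \is a polyOver S -> mu \is a polyOver S -> mu != 0 ->
  exists k Q rem, [/\ Q \is a polyOver S, rem \is a polyOver S,
    lead_coef mu ^+ k *: G = Q * mu + rem, (size rem < size mu)%N &
    (size Q <= (size G).+1 - size mu)%N].
Proof.
move=> GS muS mu0; have [n] := ubnP (size G).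
elim: n G GS => // n IH G GS lt_n.
have lcS (H : {poly R}) : H \is a polyOver S -> lead_coef H \in S.
  by move=> HS; rewrite lead_coefE; apply: (polyOverP HS).
have [lt_s|le_s] := ltnP (size G) (size mu).
  by exists 0%N, 0, G; rewrite expr0 scale1r mul0r add0r rpred0 size_poly0.
set c := lead_coef G; set d := (size G - size mu)%N.
pose T : {poly R} := c *: 'X^d.
have TS : T \is a polyOver S.
  by rewrite polyOverZ ?lcS // rpredX ?polyOverX.
pose G1 := lead_coef mu *: G - T * mu.
have G1S : G1 \is a polyOver S by rewrite rpredB ?polyOverZ ?rpredM // lcS.
have smu : (0 < size mu)%N by rewrite size_poly_gt0.
have sG : (0 < size G)%N by apply: leq_trans le_s.
have G1lt : (size G1 < size G)%N.
  rewrite -[size G]prednK // ltnS; apply/leq_sizeP => j le_j.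
  rewrite /G1 coefB coefZ /T -scalerAl coefZ mulrC [_ * mu]mulrC coefMXn.
  have -> : (j < d)%N = false.
    by rewrite /d; lia.
  move: le_j; rewrite leq_eqVlt => /orP[/eqP <-|lt_j].
    have -> : ((size G).-1 - d = (size mu).-1)%N.
      by rewrite /d -subn1 subnAC subKn // subn1.
    by rewrite -!lead_coefE -/c mulrC subrr.
  rewrite prednK // in lt_j.
  rewrite [G`_j]nth_default // mul0r sub0r nth_default ?mulr0 ?oppr0 //.
  by rewrite /d; move: le_s lt_j; move: (size mu) (size G) => a b; lia.
have [k [Q [rem [QS remS E lt_r sQ]]]] := IH G1 G1S (leq_trans G1lt lt_n).
exists k.+1, (Q + lead_coef mu ^+ k *: T), rem; split=> //.
- by rewrite rpredD // polyOverZ // rpredX // lcS.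
- by rewrite mulrDl addrAC -E /G1 scalerBr scalerA -exprSr scalerAl subrK.
- apply: leq_trans (size_polyD _ _) _; rewrite geq_max; apply/andP; split.
    by apply: leq_trans sQ _; rewrite leq_sub2r // ltnS ltnW.
  apply: leq_trans (size_scale_leq _ _) _.
  apply: leq_trans (size_scale_leq _ _) _.
  by rewrite size_polyXn /d subSn.
Qed.

Section Elimination.
Variables (R : idomainType) (S : subringClosed R) (P : R -> Prop).
Hypothesis Pp : prime_ideal P.
Variable x : R.

Definition coefs_in (G : {poly R}) := forall i, P G`_i.

(** Algebraicity of the class of [x] over the fraction field of the image of [S] in [R/P], with
    denominators cleared. *)
Definition alg_mod := exists G : {poly R},
  [/\ G \is a polyOver S, P G.[x] & ~ coefs_in G].

Lemma coefs_in_horner G y : coefs_in G -> P G.[y].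
Proof.
move=> h; rewrite horner_coef; apply: prime_ideal_sum => // i _.
by apply: prime_idealMr.
Qed.

Lemma coefs_in0 : coefs_in 0.
Proof. by move=> i; rewrite coef0; apply: prime_ideal0. Qed.

(** Dropping the top coefficients as long as they lie in [P] leaves a polynomial whose leading
    coefficient is nonzero modulo [P]. *)
Lemma coefs_in_trunc G : ~ coefs_in G ->
  exists n, ~ P (lead_coef (take_poly n G)) /\ coefs_in (G - take_poly n G).
Proof.
move=> nG; have [|n dn nmin] :=
    @exists_minimizer _ (fun n => coefs_in (G - take_poly n G)) id.
  by exists (size G); rewrite take_poly_id // subrr; apply: coefs_in0.
exists n; split=> // Pl; set H := take_poly n G in Pl dn.
have H0 : H != 0.
  by apply/eqP => H0; apply: nG; rewrite H0 subr0 in dn.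
have sH : (0 < size H)%N by rewrite size_poly_gt0.
have sHn : (size H <= n)%N by apply: size_take_poly.
suff /nmin : coefs_in (G - take_poly (size H).-1 G) by rewrite leqNgt prednK ?sHn.
move=> i; rewrite coefB coef_take_poly; case: ltnP => [_|le_i].
  by rewrite subrr; apply: prime_ideal0 Pp.
rewrite subr0; have [lt_n|le_n] := ltnP i n; last first.
  by have := dn i; rewrite coefB coef_take_poly ltnNge le_n subr0.
have -> : G`_i = H`_i by rewrite coef_take_poly lt_n.
move: le_i; rewrite leq_eqVlt => /orP[/eqP <-|lt_i]; first by rewrite -lead_coefE.
rewrite prednK // in lt_i.
by rewrite nth_default //; apply: prime_ideal0 Pp.
Qed.

Lemma coefs_in_trunc_over G : G \is a polyOver S -> ~ coefs_in G ->
  exists H : {poly R}, [/\ H \is a polyOver S, (size H <= size G)%N,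
     ~ P (lead_coef H) & coefs_in (G - H)].
Proof.
move=> GS /coefs_in_trunc[n [nl dG]]; exists (take_poly n G); split=> //.
  apply/polyOverP => i; rewrite coef_take_poly; case: ifP => _.
    exact: (polyOverP GS).
  exact: rpred0.
apply/leq_sizeP => i le_i; rewrite coef_take_poly (nth_default _ le_i).
by rewrite if_same.
Qed.

Lemma coefs_inD F G : coefs_in F -> coefs_in G -> coefs_in (F + G).
Proof. by move=> hF hG k; rewrite coefD; apply: (prime_idealD Pp) (hF k) (hG k). Qed.

Lemma coefs_inM F G : coefs_in G -> coefs_in (F * G).
Proof.
move=> hG k; rewrite coefM; apply: (prime_ideal_sum Pp) => l _.
exact: (prime_idealM Pp) (hG _).
Qed.

(** Minimal polynomial of the class of [x] up to a factor: a shortest relation whose leading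
    coefficient is outside [P]. A shorter nontrivial relation could be truncated to a shorter
    competitor. *)
Lemma minimal_poly : alg_mod -> exists mu : {poly R},
  [/\ mu \is a polyOver S, P mu.[x], ~ P (lead_coef mu) &
   forall G, G \is a polyOver S -> (size G < size mu)%N -> P G.[x] ->
     coefs_in G].
Proof.
case=> G0 [G0S G0x nG0].
pose Q (G : {poly R}) := [/\ G \is a polyOver S, P G.[x] & ~ P (lead_coef G)].
have trunc G : G \is a polyOver S -> P G.[x] -> ~ coefs_in G ->
    exists2 H : {poly R}, Q H & (size H <= size G)%N.
  move=> GS Gx nG; have [H [HS sH lH dH]] := coefs_in_trunc_over GS nG.
  exists H => //; split=> //.
  have := coefs_in_horner x dH; rewrite hornerD hornerN => h.
  have -> : H.[x] = G.[x] - (G.[x] - H.[x]) by rewrite subKr.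
  exact: prime_idealB.
have [|mu [muS mux lmu] mumin] := @exists_minimizer _ Q (fun G : {poly R} => size G).
  by have [H QH _] := trunc _ G0S G0x nG0; exists H.
exists mu; split=> // G GS sG Gx; apply: contrapT => nG.
have [H QH sH] := trunc _ GS Gx nG.
by have := mumin _ QH; rewrite leqNgt (leq_ltn_trans sH).
Qed.

(** A nonzero element of an algebraic extension divides a nonzero element of the base. Take [B] of
    least size such that [B.[x]] is a multiple of [q] and nonzero modulo [P]; it turns out to be
    constant. *)
Lemma elimination (Gq : {poly R}) : alg_mod -> Gq \is a polyOver S ->
  ~ P Gq.[x] -> exists b u, [/\ b \in S, ~ P b & P (b - Gq.[x] * u)].
Proof.
move=> /minimal_poly[mu [muS mux lmu mumin]] GqS nq; set q := Gq.[x] in nq *.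
have mu0 : mu != 0.
  apply/eqP => mu0; apply: lmu; rewrite mu0 lead_coef0; exact: prime_ideal0.
pose Q (B : {poly R}) :=
  [/\ B \is a polyOver S, ~ P B.[x] & exists u, P (B.[x] - q * u)].
have [|B [BS nB [u Bu]] Bmin] := @exists_minimizer _ Q (fun G : {poly R} => size G).
  by exists Gq; split=> //; exists 1; rewrite mulr1 subrr; apply: prime_ideal0.
have B0 : B != 0.
  apply/eqP => B0; apply: nB; rewrite B0 horner0; exact: prime_ideal0.
(* Otherwise truncate [B]: by minimality the size does not drop, and then the new leading
   coefficient, outside [P], is congruent to the old one. *)
have lB : ~ P (lead_coef B).
  move=> PlB.
  have [cB|ncB] := EM (coefs_in B).
    by apply: nB; apply: coefs_in_horner.
  have [H [HS sH lH dH]] := coefs_in_trunc_over BS ncB.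
  have dHx := coefs_in_horner x dH; rewrite hornerD hornerN in dHx.
  have QH : Q H.
    split=> //.
      move=> Hx; apply: nB; rewrite -[B.[x]](subrK H.[x]).
      exact: prime_idealD.
    exists u; have -> : H.[x] - q * u = (B.[x] - q * u) - (B.[x] - H.[x]).
      by ring.
    exact: prime_idealB.
  have := Bmin _ QH; move=> sB.
  have es : size H = size B by apply/eqP; rewrite eqn_leq sH sB.
  apply: lH; rewrite lead_coefE es.
  have := dH (size B).-1; rewrite coefB -lead_coefE => dl.
  have -> : H`_(size B).-1 = lead_coef B - (lead_coef B - H`_(size B).-1).
    by rewrite subKr.
  exact: prime_idealB.
have sB1 : (0 < size B)%N by rewrite size_poly_gt0.
have [le1|gt1] := leqP (size B) 1.
  have [c E] : exists c, B = c%:P by exists B`_0; apply: size1_polyC.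
  exists c, u; move: BS nB Bu; rewrite E hornerC => BS nB Bu.
  by split=> //; have /polyOverP/(_ 0%N) := BS; rewrite coefC.
have [le_s|lt_s] := leqP (size B) (size mu); last first.
  have [k [Q' [rem [QS remS E lt_r _]]]] := pseudo_division BS muS mu0.
  have Ex : lead_coef mu ^+ k * B.[x] = Q'.[x] * mu.[x] + rem.[x].
    by rewrite -hornerZ E hornerD hornerM.
  have /Bmin : Q rem.
    split=> //.
      move=> Pr; apply: nB; apply: (@prime_ideal_cancel _ _ Pp (lead_coef mu ^+ k)).
        exact: nprime_idealX.
      by rewrite Ex; apply: (prime_idealD Pp) => //; apply: prime_idealM.
    exists (lead_coef mu ^+ k * u).
    have -> : rem.[x] - q * (lead_coef mu ^+ k * u) =
      lead_coef mu ^+ k * (B.[x] - q * u) - Q'.[x] * mu.[x].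
      by rewrite mulrBr Ex mulrCA addrAC [_ * _ + _]addrC addrK.
    by apply: (prime_idealB Pp); apply: prime_idealM.
  by rewrite leqNgt (ltn_trans lt_r).
(* The remainder of [mu] by [B] is again a multiple of [q] at [x] and is shorter than [B], so it is
   zero modulo [P] at [x]. Hence so is [Q'], since [B.[x]] is not. *)
have [k [Q' [rem [QS remS E lt_r sQ]]]] := pseudo_division muS BS B0.
have Ex : lead_coef B ^+ k * mu.[x] = Q'.[x] * B.[x] + rem.[x].
  by rewrite -hornerZ E hornerD hornerM.
have Pr : P rem.[x].
  apply: contrapT => nr; suff /Bmin : Q rem by rewrite leqNgt lt_r.
  split=> //; exists (- (Q'.[x] * u)).
  have -> : rem.[x] - q * (- (Q'.[x] * u)) =
      lead_coef B ^+ k * mu.[x] - Q'.[x] * (B.[x] - q * u).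
    by rewrite Ex; ring.
  by apply: (prime_idealB Pp); apply: prime_idealM.
have PQ : P Q'.[x].
  have : P (Q'.[x] * B.[x]).
    have -> : Q'.[x] * B.[x] = lead_coef B ^+ k * mu.[x] - rem.[x].
      by rewrite Ex addrK.
    by apply: (prime_idealB Pp) => //; apply: prime_idealM.
  by case/(prime_idealP Pp).
have cQ : coefs_in Q'.
  apply: mumin => //; apply: leq_ltn_trans sQ _.
  by move: le_s gt1; move: (size B) (size mu) => a b; lia.
exfalso; apply: lmu.
apply: (@prime_ideal_cancel _ _ Pp (lead_coef B ^+ k)); first exact: nprime_idealX.
rewrite lead_coefE -coefZ E coefD.
rewrite [rem`_ _]nth_default; last first.
  rewrite -ltnS prednK ?(leq_trans sB1) //; exact: leq_trans lt_r le_s.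
rewrite addr0 coefM; apply: prime_ideal_sum => // i _.
exact: prime_idealMr.
Qed.

End Elimination.

(** Gauss's lemma for [P[X]]: after truncation the leading coefficients are outside [P], and so is
    their product. *)
Lemma coefs_in_prime (R : idomainType) (P : R -> Prop) (F G : {poly R}) :
  prime_ideal P -> coefs_in P (F * G) -> coefs_in P F \/ coefs_in P G.
Proof.
move=> Pp FG; apply: contrapT => /not_orP[nF nG].
have [a [lF dF]] := coefs_in_trunc Pp nF; have [b [lG dG]] := coefs_in_trunc Pp nG.
set F' := take_poly a F in lF dF; set G' := take_poly b G in lG dG.
apply: (nprime_idealM Pp lF lG); rewrite -lead_coefM lead_coefE.
suff : coefs_in P (F' * G') by apply.
move: F' G' {lF lG} dF dG => F' G' dF dG.
have -> : F' * G' = F * G + (- G) * (F - F') + (- F') * (G - G') by ring.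
by apply: (coefs_inD Pp); [apply: (coefs_inD Pp) => //|]; apply: (coefs_inM Pp).
Qed.

(** * Polynomials in a subset of the variables *)

Section Coordinates.
Variables (K : fieldType) (N : nat).
Implicit Types (p q : {mpoly K[N]}) (A B : {set 'I_N}) (v w : 'I_N -> K).

(** A boolean condition on the support, so that it carries a subring structure and can be the
    coefficient ring in [polyOver]. *)
Definition mpoly_in A : {pred {mpoly K[N]}} :=
  fun p => all (fun m : 'X_{1..N} => [forall i, (i \notin A) ==> (m i == 0%N)])
               (msupp p).

Lemma mpoly_inP A p :
  reflect (forall m, m \in msupp p -> forall i, i \notin A -> m i = 0%N)
          (p \in mpoly_in A).
Proof.
apply: (iffP allP) => h m /h.
  by move/forallP => h1 i iA; apply/eqP; apply: (implyP (h1 i)).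
by move=> h1; apply/forallP => i; apply/implyP => iA; apply/eqP/h1.
Qed.

Fact mpoly_in_subring A : subring_closed (mpoly_in A).
Proof.
split=> [|p q /mpoly_inP hp /mpoly_inP hq|p q /mpoly_inP hp /mpoly_inP hq].
- by apply/mpoly_inP => m; rewrite msupp1 inE => /eqP -> i _; rewrite mnm0E.
- apply/mpoly_inP => m /msuppB_le; rewrite mem_cat => /orP[/hp|/hq] //.
- apply/mpoly_inP => m /msuppM_le /allpairsP [[m1 m2] /= [/hp h1 /hq h2 ->]] i iA.
  by rewrite mnmDE h1 ?h2.
Qed.

HB.instance Definition _ A :=
  GRing.isSubringClosed.Build {mpoly K[N]} (mpoly_in A) (mpoly_in_subring A).

Lemma mpoly_inC A c : c%:MP \in mpoly_in A.
Proof.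
apply/mpoly_inP => m; rewrite msuppC; case: ifP => // _.
by rewrite inE => /eqP -> i _; rewrite mnm0E.
Qed.

Lemma mpoly_inX A i : i \in A -> 'X_i \in mpoly_in A.
Proof.
move=> iA; apply/mpoly_inP => m; rewrite msuppX inE => /eqP -> j jA.
by rewrite mnm1E; case: eqP => // ij; rewrite -ij iA in jA.
Qed.

Lemma mpoly_inZ A c p : p \in mpoly_in A -> c *: p \in mpoly_in A.
Proof. by move=> hp; rewrite -mul_mpolyC rpredM ?mpoly_inC. Qed.

Lemma mpoly_inS A B p : A \subset B -> p \in mpoly_in A -> p \in mpoly_in B.
Proof.
move=> /subsetP sAB /mpoly_inP h; apply/mpoly_inP => m /h h1 i iB.
by apply: h1; apply: contra iB; apply: sAB.
Qed.

Lemma mpoly_inT p : p \in mpoly_in [set: 'I_N].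
Proof. by apply/mpoly_inP => m _ i; rewrite inE. Qed.

Lemma mpoly_in_monom A p m : p \in mpoly_in A -> m \in msupp p ->
  'X_[m] \in mpoly_in A.
Proof.
by move=> /mpoly_inP h /h h1; apply/mpoly_inP => m'; rewrite msuppX inE => /eqP ->.
Qed.

Lemma mpoly_in_deriv A p i : p \in mpoly_in A -> p^`M(i) \in mpoly_in A.
Proof.
move=> /mpoly_inP h; apply/mpoly_inP => m; rewrite mcoeff_msupp mcoeff_deriv => nz j jA.
have /h/(_ j jA) : (m + U_(i))%MM \in msupp p.
  by rewrite mcoeff_msupp; apply: contraNneq nz => ->; rewrite mul0rn.
by rewrite mnmDE => /eqP; rewrite addn_eq0 => /andP[/eqP].
Qed.

Lemma mderiv_mpoly_in A p i : p \in mpoly_in A -> i \notin A -> p^`M(i) = 0.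
Proof.
move=> /mpoly_inP h iA; apply/mpolyP => m; rewrite mcoeff_deriv mcoeff0.
have -> : p@_(m + U_(i)) = 0; last by rewrite mul0rn.
apply/eqP; rewrite mcoeff_eq0; apply/negP => /h/(_ i iA).
by rewrite mnmDE mnm1E eqxx addn1.
Qed.

Lemma mevalE p v : p.@[v] = \sum_(m <- msupp p) p@_m * \prod_i v i ^+ m i.
Proof. by []. Qed.

Lemma eq_meval_in A p v w : p \in mpoly_in A -> {in A, v =1 w} -> p.@[v] = p.@[w].
Proof.
move=> /mpoly_inP h vw; rewrite !mevalE big_seq [RHS]big_seq.
apply: eq_bigr => m /h hm; congr (_ * _); apply: eq_bigr => i _.
by have [iA|/hm ->] := boolP (i \in A); [rewrite vw | rewrite !expr0].
Qed.

Lemma mpoly_in0 p : p \in mpoly_in set0 -> p = (p@_0)%:MP.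
Proof.
move=> /mpoly_inP h; apply/mpolyP => m; rewrite mcoeffC.
have [->|m0] := eqVneq m 0%MM; first by rewrite mulr1.
rewrite mulr0; apply/eqP; rewrite mcoeff_eq0; apply/negP => /h hm.
by case/eqP: m0; apply/mnmP => i; rewrite hm ?inE // mnm0E.
Qed.

Lemma mpoly_morph_eq (T : comNzRingType) (f g : {rmorphism {mpoly K[N]} -> T}) :
  (forall c, f c%:MP = g c%:MP) -> (forall i, f 'X_i = g 'X_i) -> f =1 g.
Proof.
move=> hC hX p; rewrite (mpolyE p) !rmorph_sum; apply: eq_bigr => m _.
rewrite -mul_mpolyC !rmorphM hC; congr (_ * _).
rewrite mpolyXE_id !rmorph_prod; apply: eq_bigr => i _.
by rewrite !rmorphXn hX.
Qed.

(** A polynomial seen as univariate in [X_j]. The coefficients stay in the full ring, so the number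
    of variables never changes; that they are free of [X_j] is recorded by [main_var_over]. *)
Definition main_var (j : 'I_N) : {mpoly K[N]} -> {poly {mpoly K[N]}} :=
  mmap (polyC \o @mpolyC N K) (fun i => if i == j then 'X else ('X_i)%:P).

HB.instance Definition _ j := GRing.RMorphism.on (main_var j).

Lemma main_var0 j : main_var j 0 = 0. Proof. exact: rmorph0. Qed.

Lemma main_var1 j : main_var j 1 = 1. Proof. exact: rmorph1. Qed.

Lemma main_varD j p q : main_var j (p + q) = main_var j p + main_var j q.
Proof. exact: rmorphD. Qed.

Lemma main_varM j p q : main_var j (p * q) = main_var j p * main_var j q.
Proof. exact: rmorphM. Qed.

Lemma main_varC j c : main_var j c%:MP = (c%:MP)%:P.
Proof. by rewrite /main_var mmapC. Qed.

Lemma main_varX j i : main_var j 'X_i = if i == j then 'X else ('X_i)%:P.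
Proof. by rewrite /main_var mmapX mmap1U. Qed.

Lemma main_varK j p : (main_var j p).['X_j] = p.
Proof.
rewrite -[RHS]/(idfun p) -[LHS]/((horner_eval 'X_j \o main_var j) p).
apply: mpoly_morph_eq => [c|i] /=.
  by rewrite main_varC /horner_eval hornerC.
rewrite main_varX /horner_eval; case: eqP => [->|_]; first by rewrite hornerX.
by rewrite hornerC.
Qed.

Lemma main_var_over j A p :
  p \in mpoly_in A -> main_var j p \is a polyOver (mpoly_in (A :\ j)).
Proof.
move=> /mpoly_inP h; rewrite /main_var /mmap big_seq rpred_sum // => m /h hm.
rewrite rpredM ?polyOverC ?mpoly_inC // /mmap1 rpred_prod // => i _.
have [iA|/hm ->] := boolP (i \in A); last by rewrite expr0 rpred1.
apply: rpredX; case: eqP => [_|/eqP ij]; first exact: polyOverX.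
by rewrite polyOverC mpoly_inX // !inE ij.
Qed.

Lemma main_var_in j A p : p \in mpoly_in A -> j \notin A -> main_var j p = p%:P.
Proof.
move=> /mpoly_inP h jA; rewrite [in RHS](mpolyE p) rmorph_sum /main_var /mmap.
rewrite big_seq [RHS]big_seq; apply: eq_bigr => m /h hm /=.
rewrite -mul_mpolyC rmorphM /=; congr (_ * _).
rewrite /mmap1 mpolyXE_id rmorph_prod; apply: eq_bigr => i _.
rewrite rmorphXn; case: eqP => [ij|//].
by rewrite ij hm ?expr0.
Qed.

Lemma main_var_neq0 j p : p != 0 -> main_var j p != 0.
Proof.
by apply: contraNneq => p0; rewrite -(main_varK j p) p0 horner0.
Qed.

Lemma mderiv_horner j (G : {poly {mpoly K[N]}}) l :
  G.['X_j]^`M(l) = \sum_(e < size G)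
     (G`_e^`M(l) * 'X_j ^+ e + G`_e * ('X_j ^+ e)^`M(l)).
Proof.
rewrite horner_coef raddf_sum; apply: eq_bigr => e _.
by rewrite /= mderivM.
Qed.

Lemma meval_main_var j p v w : (forall i, i != j -> w i = v i) ->
  p.@[w] = (map_poly (meval v) (main_var j p)).[w j].
Proof.
move=> vw.
rewrite -[RHS]/((horner_eval (w j) \o map_poly (meval v) \o main_var j) p).
apply: mpoly_morph_eq => [c|i] /=.
  by rewrite main_varC map_polyC /= !mevalC /horner_eval hornerC.
rewrite main_varX mevalXU /horner_eval; case: eqP => [->|/eqP ij].
  by rewrite map_polyX hornerX.
by rewrite map_polyC /= mevalXU hornerC vw.
Qed.

End Coordinates.

Definition infinite_type (K : eqType) := forall s : seq K, exists x : K, x \notin s.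

Lemma infinite_nonroot (K : fieldType) (G : {poly K}) :
  infinite_type K -> G != 0 -> exists c, ~~ root G c.
Proof.
move=> K_infinite G0.
have [s us ss] : exists2 s : seq K, uniq s & size s = size G.
  elim: (size G) => [|n [s us ss]]; first by exists [::].
  by have [x xs] := K_infinite s; exists (x :: s); rewrite /= ?xs ?us ?ss.
have : ~~ all (root G) s.
  by apply/negP => /(max_poly_roots G0)/(_ us); rewrite ss ltnn.
by move=> /allPn[c _ hc]; exists c.
Qed.

(** Induction on the variables that occur: at each [v], the specialised polynomial in [X_j] has
    every element of an infinite field as a root, so its coefficients vanish at [v]. *)
Lemma mpoly_vanish (K : fieldType) N (p : {mpoly K[N]}) :
  infinite_type K -> (forall v, p.@[v] = 0) -> p = 0.
Proof.
move=> K_infinite p0; have := mpoly_inT p; have [n] := ubnP #|[set: 'I_N]|.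
elim: n [set: 'I_N] p p0 => // n IH A p p0 lt_n pA.
have [A0|[j jA]] := set_0Vmem A.
  rewrite A0 in pA; have E := mpoly_in0 pA.
  by have := p0 (fun _ => 0); rewrite E mevalC => ->; rewrite mpolyC0.
rewrite -(main_varK j p); suff -> : main_var j p = 0 by rewrite horner0.
apply/polyP => e; rewrite coef0; apply: (IH (A :\ j)).
- move=> v; set G := map_poly (meval v) (main_var j p).
  suff G0 : G = 0 by rewrite -(coef_map (meval v)) -/G G0 coef0.
  apply/eqP; apply: contraT => /(infinite_nonroot K_infinite)[c].
  have := @meval_main_var _ _ j p v (fun i => if i == j then c else v i).
  rewrite p0 eqxx /root -/G => <-; first by rewrite eqxx.
  by move=> i /negbTE ->.
- by rewrite (cardsD1 j) jA in lt_n.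
- exact: (polyOverP (main_var_over j pA)).
Qed.

(** * Independence modulo a prime, points of closed sets *)

Section PrimeIdealsOfPolynomials.
Variables (K : fieldType) (N : nat).
Implicit Types (p q : {mpoly K[N]}) (A B J : {set 'I_N}) (P : {mpoly K[N]} -> Prop).

Definition indep_mod P A := forall p, p \in mpoly_in A -> P p -> p = 0.

Definition indep_on (S : ('I_N -> K) -> Prop) A :=
  forall p, p \in mpoly_in A -> (forall v, S v -> p.@[v] = 0) -> p = 0.

(** The last condition says that the relation [g] remains a nonzero polynomial in [X_j] modulo
    [P]. *)
Definition algebraic_over P A j :=
  exists g, [/\ g \in mpoly_in (j |: A), P g & ~ coefs_in P (main_var j g)].

Lemma indep_mod_neq P A p : indep_mod P A ->
  p \in mpoly_in A -> p != 0 -> ~ P p.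
Proof. by move=> h pA p0 Pp; rewrite (h p) ?eqxx in p0. Qed.

Lemma algebraic_overS P A B j : A \subset B -> algebraic_over P A j ->
  algebraic_over P B j.
Proof.
by move=> sAB [g [gA Pg ng]]; exists g; split=> //; apply: mpoly_inS gA; apply: setUS.
Qed.

Lemma main_var_over_setU j A p : j \notin A -> p \in mpoly_in (j |: A) ->
  main_var j p \is a polyOver (mpoly_in A).
Proof.
by move=> jA /(main_var_over j); rewrite setU1K.
Qed.

Lemma algebraic_alg_mod P A j : j \notin A -> algebraic_over P A j ->
  alg_mod (mpoly_in A) P 'X_j.
Proof.
move=> jA [g [gA Pg ng]]; exists (main_var j g).
by rewrite main_varK main_var_over_setU.
Qed.

Lemma dependent_algebraic P J j : prime_ideal P -> indep_mod P J -> j \notin J ->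
  ~ indep_mod P (j |: J) -> algebraic_over P J j.
Proof.
move=> Pp iJ jJ nJ; apply: contrapT => nalg; apply: nJ => g gJ Pg.
apply/eqP; apply: contrapT => /negP g0; apply: nalg; exists g; split=> // cg.
have := main_var_neq0 j g0; case/negP; apply/eqP/polyP => i; rewrite coef0.
by apply: iJ => //; apply: (polyOverP (main_var_over_setU jJ gJ)).
Qed.

Lemma eliminate_var P A j q : prime_ideal P -> j \notin A ->
  algebraic_over P A j -> q \in mpoly_in (j |: A) -> ~ P q ->
  exists b u, [/\ b \in mpoly_in A, ~ P b & P (b - q * u)].
Proof.
move=> Pp jA alg qA nq; rewrite -(main_varK j q) in nq *.
apply: (elimination Pp) nq; first exact: algebraic_alg_mod.
exact: main_var_over_setU.
Qed.

(** The variables outside [J] are eliminated one at a time, the multiplier [u] accumulating the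
    factors. *)
Lemma eliminate_vars P J q : prime_ideal P ->
  (forall j, j \notin J -> algebraic_over P J j) -> ~ P q ->
  exists b u, [/\ b \in mpoly_in J, ~ P b & P (b - q * u)].
Proof.
move=> Pp alg; have := mpoly_inT q; have := subsetT J.
have [n] := ubnP #|[set: 'I_N]|.
elim: n [set: 'I_N] q => // n IH B q lt_n sJB qB nq.
have [sBJ|] := boolP (B \subset J).
  exists q, 1; split=> //; first exact: mpoly_inS qB.
  by rewrite mulr1 subrr; apply: (prime_ideal0 Pp).
case/subsetPn => j jB jJ.
have [|||b [u [bB nb Pb]]] := @eliminate_var P (B :\ j) j q Pp _ _ _ nq.
- by rewrite setD11.
- by apply: algebraic_overS (alg j jJ); apply/subsetD1P.
- by rewrite setD1K.
have [||b' [u' [b'J nb' Pb']]] := IH (B :\ j) b _ _ bB nb.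
- by rewrite (cardsD1 j) jB in lt_n.
- by apply/subsetD1P.
exists b', (u * u'); split=> //.
have -> : b' - q * (u * u') = (b' - b * u') + u' * (b - q * u) by ring.
by apply: (prime_idealD Pp) => //; apply: (prime_idealM Pp).
Qed.

(* The coefficientwise ideal [P[X_i]]: in it ['X_i] is generic over everything else. *)
Lemma prime_ideal_main_var P i : prime_ideal P ->
  prime_ideal (fun p => coefs_in P (main_var i p)).
Proof.
move=> Pp; split.
- by rewrite main_var0; apply: coefs_in0.
- by move=> p q hp hq k; rewrite main_varD coefD; apply: (prime_idealD Pp) (hp k) (hq k).
- move=> a p hp k; rewrite main_varM coefM; apply: (prime_ideal_sum Pp) => l _.
  exact: (prime_idealM Pp) (hp _).
- by rewrite main_var1 => /(_ 0%N); rewrite coefC; apply: (prime_ideal1 Pp).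
by move=> p q; rewrite main_varM; apply: coefs_in_prime.
Qed.

End PrimeIdealsOfPolynomials.

(** * Lifting points over an algebraically closed field, and the Nullstellensatz *)

Section Extension.
Variables (L : closedFieldType) (N : nat).
Implicit Types (p q : {mpoly L[N]}) (A B J : {set 'I_N}) (P : {mpoly L[N]} -> Prop).

(** [F] splits into linear factors, fewer than [size F] of them, and each divides [G]. *)
Lemma closed_dvdp_exp (F G : {poly L}) e : (size F <= e)%N ->
  (forall c, root F c -> root G c) -> F != 0 -> F %| G ^+ e.
Proof.
move=> le_s h F0; have [r E] := closed_field_poly_normal F.
have lF : lead_coef F != 0 by rewrite lead_coef_eq0.
have sr : (size r <= e)%N.
  apply: leq_trans le_s; rewrite E size_scale // size_prod_XsubC; exact: leqnSn.
rewrite E dvdpZl // -(subnK sr) exprD; apply: dvdp_mull.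
have {}h c : c \in r -> 'X - c%:P %| G.
  move=> cr; rewrite dvdp_XsubCl; apply: h; rewrite E rootZ // root_prod_XsubC //.
elim: r {E sr} h => [|c r IH] h; first by rewrite big_nil dvd1p.
rewrite big_cons exprS dvdp_mul ?h ?inE ?eqxx //.
by apply: IH => c' hc'; apply: h; rewrite inE hc' orbT.
Qed.

Definition in_zeros P A (y : 'I_N -> L) :=
  forall p, p \in mpoly_in A -> P p -> p.@[y] = 0.

(** Forgetting the coordinate [j] maps the zeros with [q] nonzero onto a set containing the nonempty
    open part where [a] is nonzero. *)
Lemma extend_coordinate P A j q : prime_ideal P -> j \notin A ->
  q \in mpoly_in (j |: A) -> ~ P q ->
  exists a, [/\ a \in mpoly_in A, ~ P a &
    forall y, in_zeros P A y -> a.@[y] != 0 ->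
      exists z, [/\ forall i, i != j -> z i = y i, in_zeros P (j |: A) z & q.@[z] != 0]].
Proof.
move=> Pp jA qA nq; pose G := main_var j q.
have GA : G \is a polyOver (mpoly_in A) by apply: main_var_over_setU.
pose upd y c i : L := if i == j then c else y i.
have evE y c p : p.@[upd y c] = (map_poly (meval y) (main_var j p)).[c].
  rewrite (@meval_main_var _ _ j p y) /upd ?eqxx // => i /negbTE -> //.
have nG : ~ coefs_in P G by move=> cG; apply: nq; rewrite -(main_varK j q); apply: coefs_in_horner.
(* If [X_j] is transcendental, the elements of [P] in these variables have all their coefficients in
   [P]: any value of [X_j] is allowed, and it only has to avoid the roots of [G]. *)
have [alg|nalg] := EM (alg_mod (mpoly_in A) P 'X_j); last first.
  have [k Gk] : exists k, ~ P G`_k by apply/existsNP.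
  exists G`_k; split=> //; first exact: (polyOverP GA).
  move=> y zy nz; pose Gy := map_poly (meval y) G.
  have Gy0 : Gy != 0.
    by apply: contraNneq nz => Gy0; rewrite -coef_map -/Gy Gy0 coef0.
  have [c hc] := closed_nonrootP _ Gy0.
  exists (upd y c); split.
  - by move=> i /negbTE; rewrite /upd => ->.
  - move=> p pA Pp'; rewrite evE.
    suff -> : map_poly (meval y) (main_var j p) = 0 by rewrite horner0.
    apply/polyP => i; rewrite coef_map coef0 /=; apply: zy.
      by apply: (polyOverP (main_var_over_setU jA pA)).
    apply: contrapT => ni; apply: nalg; exists (main_var j p); split.
    + exact: main_var_over_setU.
    + by rewrite main_varK.
    + by move=> h; apply: ni.
  - by rewrite evE.
(* If [X_j] is algebraic, its value must be a root of [mu] but not of [G]. If every root of [mu] at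
   [y] were a root of [G], then [mu] would divide [G ^+ size mu] there, hence the remainder [rem],
   which is shorter and nonzero at [y]. *)
have [mu [muS mux lmu mumin]] := minimal_poly Pp alg.
have mu0 : mu != 0.
  by apply/eqP => mu0; apply: lmu; rewrite mu0 lead_coef0; apply: (prime_ideal0 Pp).
have GeA : G ^+ size mu \is a polyOver (mpoly_in A) by rewrite rpredX.
have [k [Q [rem [QS remS E lt_r _]]]] := pseudo_division GeA muS mu0.
have nrem : ~ coefs_in P rem.
  move=> crem; have : P (lead_coef mu ^+ k * q ^+ size mu).
    have -> : q ^+ size mu = (G ^+ size mu).['X_j] by rewrite horner_exp main_varK.
    rewrite -hornerZ E hornerD hornerM; apply: (prime_idealD Pp).
      exact: (prime_idealM Pp).
    exact: coefs_in_horner.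
  by apply: (nprime_idealM Pp); apply: (nprime_idealX Pp).
have [l nl] : exists l, ~ P rem`_l by apply/existsNP.
exists (lead_coef mu * rem`_l); split.
- by rewrite rpredM // ?(polyOverP remS) // lead_coefE (polyOverP muS).
- exact: (nprime_idealM Pp).
move=> y zy; rewrite mevalM mulf_eq0 => /norP[lmuy remly].
set muy := map_poly (meval y) mu.
have smuy : size muy = size mu by rewrite size_map_poly_id0.
have muy0 : muy != 0 by rewrite -size_poly_eq0 smuy size_poly_eq0.
have [c rc ngc] : exists2 c, root muy c & ~~ root (map_poly (meval y) G) c.
  apply: contrapT => no.
  have : muy %| map_poly (meval y) G ^+ size mu.
    apply: closed_dvdp_exp => //; first by rewrite smuy.
    by move=> c rc; apply: contrapT => /negP ngc; apply: no; exists c.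
  rewrite -rmorphXn /= => dv.
  have : muy %| map_poly (meval y) rem.
    have -> : map_poly (meval y) rem =
       (lead_coef mu ^+ k).@[y] *: map_poly (meval y) (G ^+ size mu)
         - map_poly (meval y) Q * muy.
      have -> : rem = lead_coef mu ^+ k *: G ^+ size mu - Q * mu by rewrite E addrC addKr.
      by rewrite rmorphB rmorphM /= map_polyZ.
    by rewrite dvdp_sub // ?dvdp_mull // -mul_polyC dvdp_mull.
  have remy0 : map_poly (meval y) rem != 0.
    by apply: contraNneq remly => r0; rewrite -coef_map r0 coef0.
  move=> /(dvdp_leq remy0); rewrite leqNgt smuy.
  by rewrite (leq_ltn_trans (size_poly _ _)).
exists (upd y c); split.
- by move=> i /negbTE; rewrite /upd => ->.
(* The remainder by [mu] of an element of [P] has its coefficients in [P], so it vanishes over [y];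
   at a root of [mu] the element itself then vanishes. *)
- move=> p pA Pp'; rewrite evE.
  have HA := main_var_over_setU jA pA.
  have [k' [Q' [rem' [QS' remS' E' lt_r' _]]]] := pseudo_division HA muS mu0.
  have crem' : coefs_in P rem'.
    apply: mumin => //.
    have -> : rem' = lead_coef mu ^+ k' *: main_var j p - Q' * mu by rewrite E' addrC addKr.
    rewrite hornerD hornerN hornerZ hornerM main_varK.
    by apply: (prime_idealB Pp); apply: (prime_idealM Pp).
  have remy : map_poly (meval y) rem' = 0.
    by apply/polyP => i; rewrite coef_map coef0 /=; apply: zy; first exact: (polyOverP remS').
  have /(congr1 (fun H => (map_poly (meval y) H).[c])) := E'.
  rewrite rmorphD rmorphM /= map_polyZ /= remy addr0 hornerZ hornerM (rootP rc) mulr0.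
  move/eqP; rewrite mulf_eq0 rmorphXn expf_eq0 (negbTE lmuy) andbF /=.
  by move/eqP.
- by rewrite evE.
Qed.

Lemma extend_point P J q : prime_ideal P -> ~ P q ->
  exists a, [/\ a \in mpoly_in J, ~ P a &
    forall y, in_zeros P J y -> a.@[y] != 0 ->
      exists z, [/\ {in J, z =1 y}, forall p, P p -> p.@[z] = 0 & q.@[z] != 0]].
Proof.
move=> Pp nq.
suff [a [aJ na ha]] : exists a, [/\ a \in mpoly_in J, ~ P a &
    forall y, in_zeros P J y -> a.@[y] != 0 ->
      exists z, [/\ {in J, z =1 y}, in_zeros P [set: 'I_N] z & q.@[z] != 0]].
  exists a; split=> // y zy nz; have [z [h1 h2 h3]] := ha y zy nz.
  by exists z; split=> // p; apply: h2; apply: mpoly_inT.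
move: nq; have := mpoly_inT q; have := subsetT J.
have [n] := ubnP #|[set: 'I_N]|.
elim: n [set: 'I_N] q => // n IH B q lt_n sJB qB nq.
have [sBJ|] := boolP (B \subset J).
  have -> : J = B by apply/eqP; rewrite eqEsubset sJB.
  by exists q; split=> // y zy nz; exists y; split.
case/subsetPn => j jB jJ.
have [||b [bB nb hb]] := @extend_coordinate P (B :\ j) j q Pp _ _ nq.
- by rewrite setD11.
- by rewrite setD1K.
have [||a [aJ na ha]] := IH (B :\ j) b _ _ bB nb.
- by rewrite (cardsD1 j) jB in lt_n.
- by apply/subsetD1P.
exists a; split=> // y zy nz.
have [z [zJ zz bz]] := ha y zy nz.
have [w [wz wB qw]] := hb z zz bz.
rewrite setD1K // in wB; exists w; split=> // i iJ.
by rewrite wz ?zJ //; apply: contraNneq jJ => <-.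
Qed.

(** Extension of the point from no coordinates at all: the only constant in [P] is zero, so every
    starting point is admissible. *)
Lemma nullstellensatz P q : prime_ideal P -> ~ P q ->
  exists2 z, forall p, P p -> p.@[z] = 0 & q.@[z] != 0.
Proof.
move=> Pp nq; have [a [a0 na ha]] := extend_point set0 Pp nq.
have cst p : p \in mpoly_in set0 -> p != 0 -> ~ P p.
  move=> /mpoly_in0 -> ; rewrite mpolyC_eq0 => p0 Pp'.
  apply: (prime_ideal1 Pp); have := prime_idealM Pp (p@_0)^-1%:MP Pp'.
  by rewrite -mpolyCM mulVf.
have [||z [_ zP qz]] := ha (fun=> 0).
- move=> p pA Pp'; have [->|p0] := eqVneq p 0; first by rewrite meval0.
  by case: (cst p pA p0).
- have E := mpoly_in0 a0; rewrite E mevalC; apply/eqP => a00.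
  by apply: na; rewrite E a00 mpolyC0; apply: (prime_ideal0 Pp).
by exists z.
Qed.

End Extension.

(** * Generic primes of sets of points *)

(** For finitely many elements of [P] and one polynomial outside [P], some point of [S] behaves like
    the generic point of [P]. *)
Definition dense_for (K : fieldType) (N : nat) (S : ('I_N -> K) -> Prop)
    (P : {mpoly K[N]} -> Prop) :=
  forall (ps : seq {mpoly K[N]}) h, (forall p, p \in ps -> P p) -> ~ P h ->
    exists v, [/\ S v, forall p, p \in ps -> p.@[v] = 0 & h.@[v] != 0].

Section GenericPrime.
Variables (K : fieldType) (N : nat) (S : ('I_N -> K) -> Prop) (J : {set 'I_N}).
Hypothesis iJ : indep_on S J.
Implicit Types (p q : {mpoly K[N]}) (ps : seq {mpoly K[N]}).

(** A finite intersection property, suited to Zorn's lemma. Asking for points off every hypersurface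
    in the coordinates [J] keeps [J] independent modulo a maximal such [X]. *)
Definition consistent (X : {mpoly K[N]} -> Prop) :=
  forall ps q, (forall p, p \in ps -> X p) -> q \in mpoly_in J -> q != 0 ->
    exists v, [/\ S v, forall p, p \in ps -> p.@[v] = 0 & q.@[v] != 0].

Lemma indep_on_point q : q \in mpoly_in J -> q != 0 -> exists2 v, S v & q.@[v] != 0.
Proof.
move=> qJ q0; apply: contrapT => no; move/eqP: q0; apply; apply: iJ => // v Sv.
by apply/eqP; apply: contrapT => /negP nz; apply: no; exists v.
Qed.

Lemma maximal_consistent : exists2 X, consistent X &
  forall Y, consistent Y -> (forall p, X p -> Y p) -> forall p, Y p -> X p.
Proof.
have c0 : consistent (fun _ => False).
  move=> [|p ps] q h qJ q0; last by case: (h p); rewrite inE eqxx.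
  by have [v Sv qv] := indep_on_point qJ q0; exists v.
pose T := {X | consistent X}; pose le (X Y : T) := `[< forall p, sval X p -> sval Y p >].
have [||A totA|X Xmax] := @classical_sets.ZL_preorder T (exist _ _ c0) le.
- by move=> X; apply/asboolP.
- by move=> Y X Z /asboolP XY /asboolP YZ; apply/asboolP => p /XY /YZ.
- have cU : consistent (fun p => exists2 X : T, A X & sval X p).
    move=> ps q hps qJ q0.
    (* A finite list from the union of a chain lies in one member; the empty list is apart because
       the chain may be empty. *)
    have [->|[X AX hX]] : ps = [::] \/ exists2 X : T, A X & forall p, p \in ps -> sval X p.
      elim: ps hps => [|p ps IH] hps; [by left | right].
      have [X AX Xp] : exists2 X : T, A X & sval X p by apply: hps; rewrite inE eqxx.
      have [->|[Y AY hY]] := IH (fun p' h => hps p' (mem_behead (s := p :: ps) h)).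
        by exists X => // p'; rewrite inE => /eqP ->.
      have [/asboolP XY|/asboolP YX] := totA X Y AX AY.
        exists Y => // p'; rewrite inE => /orP[/eqP ->|/hY //]; exact: XY.
      exists X => // p'; rewrite inE => /orP[/eqP -> //|/hY]; exact: YX.
    by have [v Sv qv] := indep_on_point qJ q0; exists v.
    exact: (svalP X) hX qJ q0.
  by exists (exist _ _ cU) => X AX; apply/asboolP => p Xp; exists X.
exists (sval X); first exact: svalP.
move=> Y cY XY p; have /asboolP := Xmax (exist _ Y cY) (asboolT XY); exact.
Qed.

(** A maximal consistent set is the required prime: everything follows from the description of its
    complement in [out]. *)
Lemma generic_prime : exists P, [/\ prime_ideal P,
  forall p, (forall v, S v -> p.@[v] = 0) -> P p, indep_mod P J & dense_for S P].
Proof.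
have [X cX Xmax] := maximal_consistent.
(* Since adding [h] destroys consistency, [h] vanishes nowhere on the part of [S] given by some
   finite list in [X] and one inequation over [J]. *)
have out h : ~ X h -> exists ps q, [/\ forall p, p \in ps -> X p, q \in mpoly_in J,
    q != 0 & forall v, S v -> (forall p, p \in ps -> p.@[v] = 0) -> q.@[v] != 0 ->
    h.@[v] != 0].
  move=> nh; apply: contrapT => no; apply: nh.
  apply: (Xmax (fun p => X p \/ p = h)); [|by left|by right].
  move=> ps q hps qJ q0; pose ps' := [seq p <- ps | p != h].
  have hps' p : p \in ps' -> X p.
    by rewrite mem_filter => /andP[/eqP ph /hps[]].
  apply: contrapT => nv; apply: no; exists ps', q; split=> // v Sv psv qv.
  apply: contra_notN nv => /eqP hv; exists v; split=> // p pps.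
  by have [->//|ph] := eqVneq p h; apply: psv; rewrite mem_filter ph.
have catX ps ps' : (forall p, p \in ps -> X p) -> (forall p, p \in ps' -> X p) ->
    forall p, p \in ps ++ ps' -> X p.
  by move=> h h' p; rewrite mem_cat => /orP[/h|/h'].
have into ps q h : (forall p, p \in ps -> X p) -> q \in mpoly_in J -> q != 0 ->
    (forall v, S v -> (forall p, p \in ps -> p.@[v] = 0) -> q.@[v] != 0 -> h.@[v] = 0) ->
    X h.
  move=> hps qJ q0 hh; apply: contrapT => /out[ps' [q' [hps' qJ' q0' hh']]].
  have [|||v [Sv psv]] := cX (ps ++ ps') (q * q').
  - exact: catX.
  - exact: rpredM.
  - exact: mulf_neq0.
  rewrite mevalM mulf_eq0 => /norP[qv qv'].
  have /eqP[] := hh' v Sv (fun p pp => psv p ltac:(by rewrite mem_cat pp orbT)) qv'.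
  by apply: hh => // p pp; apply: psv; rewrite mem_cat pp.
have one0 : (1 : {mpoly K[N]}) != 0 by apply: oner_neq0.
have one_in : (1 : {mpoly K[N]}) \in mpoly_in J by apply: rpred1.
exists X; split.
- split.
  + by apply: (into [::] 1) => // v _ _ _; rewrite meval0.
  + move=> p q Xp Xq; apply: (into [:: p; q] 1) => //.
      by move=> r; rewrite !inE => /orP[]/eqP ->.
    move=> v _ pqv _; by rewrite mevalD !pqv ?addr0 ?inE ?eqxx ?orbT.
  + move=> a p Xp; apply: (into [:: p] 1) => //.
      by move=> r; rewrite !inE => /eqP ->.
    by move=> v _ pv _; rewrite mevalM (pv p) ?mulr0 ?inE ?eqxx.
  + move=> X1; have [|v [_ v1 /negP[]]] := cX [:: 1] 1 _ one_in one0.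
      by move=> r; rewrite !inE => /eqP ->.
    by rewrite v1 // ?inE.
  (* If [p] and [q] were both outside, consistency would give a point meeting the conditions of
     both, where [p * q] is at once zero and nonzero. *)
  move=> p q Xpq; apply: contrapT => /not_orP[/out[ps [a [hps aJ a0 ha]]]].
  move=> /out[ps' [b [hps' bJ b0 hb]]].
  have [|||v [Sv psv]] := cX (p * q :: ps ++ ps') (a * b).
  - move=> r; rewrite inE => /orP[/eqP -> //|]; exact: catX.
  - exact: rpredM.
  - exact: mulf_neq0.
  rewrite mevalM mulf_eq0 => /norP[av bv].
  have : (p * q).@[v] != 0.
    rewrite mevalM mulf_neq0 //.
      by apply: ha => // r rr; apply: psv; rewrite inE mem_cat rr orbT.
    by apply: hb => // r rr; apply: psv; rewrite inE mem_cat rr !orbT.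
  by rewrite psv ?inE ?eqxx.
- by move=> p pS; apply: (into [::] 1) => // v Sv _ _; apply: pS.
- move=> q qJ Xq; apply/eqP; apply: contrapT => /negP q0.
  have [|v [_ v1 /negP[]]] := cX [:: q] q _ qJ q0.
    by move=> r; rewrite !inE => /eqP ->.
  by rewrite v1 // ?inE.
- move=> ps h hps /out[ps' [q [hps' qJ q0 hh]]].
  have [v [Sv psv qv]] := cX (ps ++ ps') q (catX _ _ hps hps') qJ q0.
  exists v; split=> //; first by move=> p pp; apply: psv; rewrite mem_cat pp.
  by apply: hh => // p pp; apply: psv; rewrite mem_cat pp orbT.
Qed.

End GenericPrime.

(* [phi] will be both the embedding of [K] into [L] and the Frobenius of [K]. *)
Lemma semilinear_independent_sum (K L : fieldType) (phi : {rmorphism K -> L})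
    (V : lmodType K) (W : lmodType L) (Psi : {additive V -> W}) (Q : V -> Prop)
    (k : nat) (c : 'I_k -> L) (m : 'I_k -> V) :
  (forall a x, Psi (a *: x) = phi a *: Psi x) ->
  (forall a x y, Q x -> Q y -> Q (x + a *: y)) -> (forall i, Q (m i)) ->
  exists k' (c' : 'I_k' -> L) (m' : 'I_k' -> V),
    [/\ forall i, Q (m' i),
        \sum_i c i *: Psi (m i) = \sum_i c' i *: Psi (m' i) &
        forall b, \sum_i c' i * phi (b i) = 0 -> forall i, b i = 0].
Proof.
move=> PsiZ QZ; elim: k c m => [|k IH] c m Qm.
  by exists 0%N, c, m; split=> // b _ [].
have [ind|] := EM (forall b, \sum_i c i * phi (b i) = 0 -> forall i, b i = 0).
  by exists k.+1, c, m; split.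
move/existsNP => [b /not_implyP[b0 /existsNP[j /eqP bj]]].
(* The relation [b] expresses [c j] through the other coefficients, so the term [j] is absorbed and
   the number of terms drops. *)
pose m1 (i : 'I_k) := m (lift j i) + (- (b (lift j i) / b j)) *: m j.
have [|k' [c' [m' [Qm' E ind]]]] := IH (fun i => c (lift j i)) m1.
  by move=> i; apply: QZ.
exists k', c', m'; split=> //; rewrite -E (bigD1_ord j) //=.
have cj : c j = - \sum_i c (lift j i) * phi (b (lift j i) / b j).
  move: b0; rewrite (bigD1_ord j) //= => /(canRL (addrK _)); rewrite sub0r.
  move/(canRL (mulfK _)) => -> //; last by rewrite fmorph_eq0.
  rewrite mulNr mulr_suml; congr (- _); apply: eq_bigr => i _.
  by rewrite rmorphM fmorphV mulrA.
rewrite cj scaleNr scaler_suml -sumrN -big_split /=; apply: eq_bigr => i _.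
by rewrite /m1 raddfD /= PsiZ rmorphN scaleNr scalerBr scalerA addrC.
Qed.

(** * Dimension of the closure *)

Section Substitution.
Variables (K : fieldType) (N : nat).

Definition subst_mpoly (h : 'I_N -> {mpoly K[N]}) : {mpoly K[N]} -> {mpoly K[N]} :=
  mmap (@mpolyC N K) h.

HB.instance Definition _ h := GRing.RMorphism.on (subst_mpoly h).

Lemma subst_mpolyC h c : subst_mpoly h c%:MP = c%:MP.
Proof. by rewrite /subst_mpoly mmapC. Qed.

Lemma subst_mpolyX h i : subst_mpoly h 'X_i = h i.
Proof. by rewrite /subst_mpoly mmapX mmap1U. Qed.

Lemma meval_subst_mpoly h p w :
  (subst_mpoly h p).@[w] = p.@[fun i => (h i).@[w]].
Proof.
rewrite -[LHS]/((meval w \o subst_mpoly h) p).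
apply: mpoly_morph_eq => [c|i] /=; first by rewrite subst_mpolyC !mevalC.
by rewrite subst_mpolyX mevalXU.
Qed.

Lemma subst_mpoly_in A h p : (forall i, h i \in mpoly_in A) ->
  subst_mpoly h p \in mpoly_in A.
Proof.
move=> hA; rewrite /subst_mpoly /mmap rpred_sum // => m _.
by rewrite rpredM ?mpoly_inC // /mmap1 rpred_prod // => i _; rewrite rpredX.
Qed.

End Substitution.

(** * Independence of coordinates under extension of scalars *)

Section ScalarExtension.
Variables (K L : fieldType) (iota : {rmorphism K -> L}) (N : nat).
Implicit Types (S : ('I_N -> K) -> Prop) (J : {set 'I_N}).

Lemma meval_map_mpoly (p : {mpoly K[N]}) v :
  (map_mpoly iota p).@[iota \o v] = iota p.@[v].
Proof.
rewrite -[LHS]/((meval (iota \o v) \o map_mpoly iota) p) -[RHS]/((iota \o meval v) p).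
apply: mpoly_morph_eq => [c|i] /=.
  by rewrite map_mpolyC !mevalC.
by rewrite map_mpolyX !mevalXU.
Qed.

Lemma map_mpolyZ a (p : {mpoly K[N]}) :
  map_mpoly iota (a *: p) = iota a *: map_mpoly iota p.
Proof. by rewrite -!mul_mpolyC rmorphM /= map_mpolyC. Qed.

Lemma kclosure_sub S v : S v -> kclosure iota S (iota \o v).
Proof. by move=> Sv q [p [pS ->]]; rewrite meval_map_mpoly pS ?rmorph0. Qed.

(** Write [q] as a combination of polynomials over [K] with coefficients in [L] that are linearly
    independent over [K]. At a point of [S] these polynomials take values in [K], so each of them
    vanishes on [S]. *)
Lemma indep_on_kclosure S J : indep_on S J -> indep_on (kclosure iota S) J.
Proof.
move=> iJ q qJ q0; set k := size (msupp q).
pose mon (i : 'I_k) := nth 0%MM (msupp q) i.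
have [||i|k' [c' [m' [m'J E ind]]]] := @semilinear_independent_sum K L iota
  {mpoly K[N]} {mpoly L[N]} (map_mpoly iota) (fun p => p \in mpoly_in J) k
  (fun i => q@_(mon i)) (fun i => 'X_[mon i]).
- exact: map_mpolyZ.
- by move=> a x y xJ yJ; rewrite rpredD ?mpoly_inZ.
- have := mpoly_in_monom qJ (mem_nth 0%MM (ltn_ord i)).
  move=> /mpoly_inP h; apply/mpoly_inP => m; rewrite msuppX => mi.
  by apply: h; rewrite msuppX.
have {E} : q = \sum_i c' i *: map_mpoly iota (m' i).
  rewrite -E {1}(mpolyE q) (big_nth 0%MM) big_mkord.
  by apply: eq_bigr => i _; rewrite /= map_mpolyX.
move=> E; rewrite E big1 // => i _.
rewrite (iJ (m' i)) ?raddf0 ?scaler0 // => v Sv.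
apply: (ind (fun i => (m' i).@[v])).
rewrite -[RHS](q0 _ (kclosure_sub Sv)) E (raddf_sum (meval (iota \o v))) /=.
apply: eq_bigr => l _.
by rewrite /= mevalZ meval_map_mpoly.
Qed.

Lemma indep_on_kclosure_inv S J : indep_on (kclosure iota S) J -> indep_on S J.
Proof.
move=> iJ p /mpoly_inP pJ pS.
have E : map_mpoly iota p = 0.
  apply: iJ => [|v]; last by apply; exists p.
  apply/mpoly_inP => m.
  rewrite (perm_mem (msupp_map_mpoly p (fmorph_inj iota))); exact: pJ.
apply/mpolyP => m; apply/eqP; rewrite mcoeff0 -(fmorph_eq0 iota) -mcoeff_map_mpoly E.
by rewrite mcoeff0.
Qed.

End ScalarExtension.

(** * Chains of irreducible closed sets are bounded by independent coordinates *)

Section UpperBoundChains.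
Variables (L : fieldType) (N : nat).
Implicit Types (C V : ('I_N -> L) -> Prop) (J : {set 'I_N}).

Lemma zclosed_zero_set (P : {mpoly L[N]} -> Prop) : zclosed (zero_set P).
Proof. by exists P. Qed.

Lemma zclosedI V1 V2 : zclosed V1 -> zclosed V2 -> zclosed (fun v => V1 v /\ V2 v).
Proof.
move=> [P1 h1] [P2 h2]; exists (fun p => P1 p \/ P2 p) => v; split.
  by case=> /h1 z1 /h2 z2 p [/z1|/z2].
by move=> z; split; [apply/h1|apply/h2] => p Pp; apply: z; [left|right].
Qed.

Lemma zclosed_hyper p : zclosed (fun v : 'I_N -> L => p.@[v] = 0).
Proof. by exists (eq p) => v; split=> [pv q <- //|]; apply. Qed.

Lemma irreducible_prime C : zirreducible C ->
  prime_ideal (fun p => forall v, C v -> p.@[v] = 0).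
Proof.
case=> _ [v0 Cv0] irr; split.
- by move=> v _; rewrite meval0.
- by move=> p q hp hq v Cv; rewrite mevalD hp ?hq ?addr0.
- by move=> a p hp v Cv; rewrite mevalM hp ?mulr0.
- by move=> /(_ v0 Cv0)/eqP; rewrite meval1 oner_eq0.
move=> p q pq; apply: (irr _ _ (zclosed_hyper p) (zclosed_hyper q)) => v Cv.
by have /eqP := pq v Cv; rewrite mevalM mulf_eq0 => /orP[]/eqP; [left|right].
Qed.

Lemma indep_on_sub V C J : subset_of C V -> indep_on C J -> indep_on V J.
Proof. by move=> sCV iJ p pJ pV; apply: iJ => // v /sCV; apply: pV. Qed.

Lemma indep_on0 V : (exists v, V v) -> indep_on V set0.
Proof.
by move=> [v Vv] p /mpoly_in0 E h; have := h v Vv; rewrite E mevalC => ->; rewrite mpolyC0.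
Qed.

(** Otherwise every coordinate is algebraic over [J] on [C']. An equation of [C] that is nonzero
    somewhere on [C'] then divides, modulo the ideal of [C'], a nonzero polynomial in [J], which
    vanishes on [C]. *)
Lemma irreducible_indep_lt C C' J : zirreducible C -> zirreducible C' ->
  strict_subset_of C C' -> indep_on C J ->
  exists2 J', indep_on C' J' & (#|J| < #|J'|)%N.
Proof.
move=> irC irC' [sCC' [v [C'v nCv]]] iJ; apply: contrapT => no.
have Pp := irreducible_prime irC'.
have iJ' : indep_on C' J by apply: indep_on_sub iJ.
have alg j : j \notin J ->
    algebraic_over (fun p => forall v, C' v -> p.@[v] = 0) J j.
  move=> jJ; apply: dependent_algebraic => // ij; apply: no; exists (j |: J) => //.
  by rewrite cardsU1 jJ.
have [[Q hQ] _ _] := irC.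
have [p Qp pv] : exists2 p, Q p & p.@[v] != 0.
  apply: contrapT => np; apply: nCv; apply/hQ => p Qp.
  by apply/eqP; apply: contrapT => /negP pv; apply: np; exists p.
have [|b [u [bJ nb bu]]] := eliminate_vars (q := p) Pp alg.
  by move=> h; rewrite h ?eqxx in pv.
apply: nb => w _; suff -> : b = 0 by rewrite meval0.
apply: iJ => // x Cx; have /eqP := bu x (sCC' x Cx).
have /hQ/(_ p Qp) px := Cx.
by rewrite mevalB mevalM px mul0r subr0 => /eqP.
Qed.

Lemma chain_indep V m : has_chain V m -> exists2 J, indep_on V J & (m <= #|J|)%N.
Proof.
case=> C [irC sC].
suff [J iJ le_m] : exists2 J, indep_on (C m) J & (m <= #|J|)%N.
  by exists J => //; apply: indep_on_sub iJ; have [] := irC m (leqnn m).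
elim: {-2}m (leqnn m) => [_|k IH lt_k].
  by exists set0 => //; apply: indep_on0; have [[]] := irC 0%N isT.
have [J iJ le_k] := IH (ltnW lt_k).
have [[irk _] [irk1 _]] := (irC k (ltnW lt_k), irC k.+1 lt_k).
have [J' iJ' lt_J] := irreducible_indep_lt irk irk1 (sC k lt_k) iJ.
by exists J' => //; apply: leq_ltn_trans lt_J.
Qed.

End UpperBoundChains.

(** * Independent coordinates give chains of irreducible closed sets *)

Section ExistenceOfChains.
Variables (L : closedFieldType) (N : nat).
Implicit Types (Z : ('I_N -> L) -> Prop) (J : {set 'I_N}).

Lemma closed_infinite : infinite_type L.
Proof.
move=> s; have p0 : \prod_(z <- s) ('X - z%:P) != 0 :> {poly L}.
  by rewrite monic_neq0 // monic_prod_XsubC.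
by have [x hx] := closed_nonrootP _ p0; exists x; rewrite root_prod_XsubC in hx.
Qed.

Lemma zero_set_irreducible (P : {mpoly L[N]} -> Prop) :
  prime_ideal P -> zirreducible (zero_set P).
Proof.
move=> Pp; split; first exact: zclosed_zero_set.
  by have [v Pv _] := nullstellensatz Pp (prime_ideal1 Pp); exists v.
move=> V1 V2 [P1 h1] [P2 h2] cov; apply: contrapT => /not_orP[n1 n2].
have out V Q : (forall v, V v <-> zero_set Q v) -> ~ subset_of (zero_set P) V ->
    exists2 p, Q p & ~ P p.
  move=> hV nV; apply: contrapT => no; apply: nV => v Pv; apply/hV => p Qp.
  by apply: Pv; apply: contrapT => nPp; apply: no; exists p.
have [p1 Q1 np1] := out _ _ h1 n1; have [p2 Q2 np2] := out _ _ h2 n2.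
have [z zP] := nullstellensatz Pp (nprime_idealM Pp np1 np2).
rewrite mevalM; have [/h1/(_ p1 Q1) ->|/h2/(_ p2 Q2) ->] := cov z zP.
  by rewrite mul0r eqxx.
by rewrite mulr0 eqxx.
Qed.

Lemma generic_irreducible Z J : zclosed Z -> indep_on Z J ->
  exists P, [/\ prime_ideal P, indep_mod P J & subset_of (zero_set P) Z].
Proof.
move=> [Q hQ] iJ; have [P [Pp PZ iP _]] := generic_prime iJ.
exists P; split=> // v Pv; apply/hQ => p Qp; apply: Pv; apply: PZ => w /hQ; exact.
Qed.

Lemma mpolyX_sub_neq0 (K : fieldType) (j : 'I_N) (c : K) : 'X_j - c%:MP != 0 :> {mpoly K[N]}.
Proof.
apply/eqP => /(congr1 (mcoeff U_(j))); rewrite mcoeffB mcoeffXU eqxx mcoeffC mnm1_eq0.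
by rewrite mulr0 subr0 mcoeff0 => /eqP; rewrite oner_eq0.
Qed.

(** Cut an irreducible subset of [Z] on which [J] is independent by a hyperplane [X_j = y j] in
    general position: one independent coordinate is lost, and the uncut set goes on top of the chain
    obtained by induction. *)
Lemma indep_chain Z J : zclosed Z -> indep_on Z J -> has_chain Z #|J|.
Proof.
move En : #|J| => n; elim: n Z J En => [|n IH] Z J En cZ iJ.
  have [P [Pp iP PZ]] := generic_irreducible cZ iJ.
  by exists (fun=> zero_set P); split=> // k _; split=> //; apply: zero_set_irreducible.
have [P [Pp iP PZ]] := generic_irreducible cZ iJ.
have /card_gt0P[j jJ] : (0 < #|J|)%N by rewrite En.
have [a [aJ na ha]] := extend_point J Pp (prime_ideal1 Pp).
have [y ay] : exists y, a.@[y] != 0.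
  apply: contrapT => no; apply: na; suff -> : a = 0 by apply: (prime_ideal0 Pp).
  apply: (mpoly_vanish closed_infinite) => y.
  by apply/eqP; apply: contrapT => /negP ay; apply: no; exists y.
pose Z' v := zero_set P v /\ ('X_j - (y j)%:MP).@[v] = 0.
have cZ' : zclosed Z'.
  by apply: zclosedI; [exact: zclosed_zero_set | exact: zclosed_hyper].
have iJ' : indep_on Z' (J :\ j).
  move=> g gJ gZ; apply/eqP; apply: contrapT => /negP g0.
  pose a1 := subst_mpoly (fun i => if i == j then (y j)%:MP else 'X_i) a.
  have a1E w : a1.@[w] = a.@[fun i => if i == j then y j else w i].
    rewrite meval_subst_mpoly; apply: meval_eq => i; case: ifP => _.
      by rewrite mevalC.
    by rewrite mevalXU.
  have a10 : a1 != 0.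
    apply: contraNneq ay => a10; have := a1E y; rewrite a10 meval0 => /esym h.
    by rewrite -h; apply/eqP; apply: meval_eq => i; case: eqP => [->|].
  (* Since [a1] is nonzero at [w], the point [w] with [X_j] set to [y j] lifts to a point of [Z'];
     there [g] takes its value at [w], which is nonzero. *)
  have [w] : exists w, (a1 * g).@[w] != 0.
    apply: contrapT => no; case/negP: (mulf_neq0 a10 g0); apply/eqP.
    apply: (mpoly_vanish closed_infinite) => w.
    by apply/eqP; apply: contrapT => /negP aw; apply: no; exists w.
  rewrite mevalM mulf_eq0 => /norP[a1w gw].
  rewrite a1E in a1w.
  have [|z [zw zP _]] := ha _ _ a1w.
    by move=> p pJ Pp'; rewrite (iP p) ?meval0.
  case/negP: gw; apply/eqP; rewrite -(gZ z); last first.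
    split=> //; rewrite mevalB mevalXU mevalC zw // eqxx subrr //.
  apply: eq_meval_in gJ _ => i; rewrite !inE => /andP[ij iJi].
  by rewrite zw // (negbTE ij).
have [|C [irC sC]] := IH Z' (J :\ j) _ cZ' iJ'.
  by move: En; rewrite (cardsD1 j) jJ => -[].
exists (fun k => if (k <= n)%N then C k else zero_set P); split=> k.
  rewrite leq_eqVlt => /orP[/eqP ->|].
    by rewrite ltnn; split=> //; apply: zero_set_irreducible.
  rewrite ltnS => le_k; rewrite le_k; have [irk sk] := irC k le_k.
  by split=> // v /sk[/PZ].
rewrite ltnS => le_k; rewrite le_k; case: ltnP => [lt_k|ge_k]; first exact: sC.
have -> : k = n by apply/eqP; rewrite eqn_leq le_k ge_k.
split; first by move=> v; have [_ h] := irC n (leqnn n); case/h.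
(* Strictness at the top: a nonzero polynomial in the coordinates [J] cannot lie in [P]. *)
have nP : ~ P ('X_j - (y j)%:MP).
  apply: (indep_mod_neq iP); last exact: mpolyX_sub_neq0.
  by rewrite rpredB ?mpoly_inX ?mpoly_inC.
have [z zP zj] := nullstellensatz Pp nP.
exists z; split=> // Cz; have [_ /(_ z Cz)[_ h]] := irC n (leqnn n).
by rewrite h eqxx in zj.
Qed.

End ExistenceOfChains.

Lemma dim_kclosure (K : fieldType) (L : closedFieldType) (iota : {rmorphism K -> L})
    (N : nat) (S : ('I_N -> K) -> Prop) : (exists v, S v) ->
  exists J, [/\ indep_on S J, forall J', indep_on S J' -> (#|J'| <= #|J|)%N &
    dim_is (kclosure iota S) #|J|].
Proof.
move=> /indep_on0 i0.
have [|J iJ Jmax] := @exists_minimizer _ (indep_on S) (fun J => (N - #|J|)%N).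
  by exists set0.
have {}Jmax J' : indep_on S J' -> (#|J'| <= #|J|)%N.
  have le_N (A : {set 'I_N}) : (#|A| <= N)%N by rewrite -[X in (_ <= X)%N]card_ord max_card.
  by move=> /Jmax; move: (le_N J) (le_N J'); move: #|J| #|J'| => a b; lia.
exists J; split=> //; split.
  by apply: indep_chain; [exact: zclosed_zero_set | exact: indep_on_kclosure].
move=> m /chain_indep[J' iJ' le_m]; apply: leq_trans le_m (Jmax _ _).
exact: indep_on_kclosure_inv iJ'.
Qed.

(** * Separability *)

Section Separability.
Variables (K : fieldType) (N : nat).
Implicit Types (p q : {mpoly K[N]}) (A B J : {set 'I_N}) (P : {mpoly K[N]} -> Prop).

Lemma msize_mderiv_lt i q : q != 0 -> (msize q^`M(i) < msize q)%N.
Proof.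
move=> q0; have sq : (0 < msize q)%N by rewrite lt0n msize_poly_eq0.
rewrite msizeE -(prednK sq) ltnS; apply/bigmax_leqP_seq => m.
rewrite mcoeff_msupp mcoeff_deriv => nz _; rewrite -ltnS prednK //.
have /msize_mdeg_lt : (m + U_(i))%MM \in msupp q.
  by rewrite mcoeff_msupp; apply: contraNneq nz => ->; rewrite mul0rn.
by rewrite mdegD mdeg1 addn1.
Qed.

(* In characteristic [p] this is the reducedness of the ideal of a set of      *)
(* [K]-points: a [q] all of whose partial derivatives lie in [P] would be a     *)
(* combination of [p]-th powers, and separating its coefficients over [K^p]    *)
(* produces an element of [P] of smaller degree.                               *)
Lemma separating_relation (S : ('I_N -> K) -> Prop) P B : prime_ideal P ->
  dense_for S P -> ~ indep_mod P B ->
  exists q i, [/\ q \in mpoly_in B, P q & ~ P q^`M(i)].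
Proof.
move=> Pp dP nB.
have [|q [qB Pq q0] qmin] := @exists_minimizer _
    (fun q => [/\ q \in mpoly_in B, P q & q != 0]) (fun q => msize q).
  apply: contrapT => no; apply: nB => p pB Pp'; apply/eqP; apply: contrapT => /negP p0.
  by apply: no; exists p.
apply: contrapT => no.
(* The derivatives lie in [P] and are smaller than [q], so minimality makes them zero. *)
have {no} dq i : q^`M(i) = 0.
  apply/eqP; apply: contrapT => /negP dq0.
  have Pd : P q^`M(i) by apply: contrapT => nd; apply: no; exists q, i.
  have := qmin _ (And3 (mpoly_in_deriv i qB) Pd dq0).
  by rewrite leqNgt msize_mderiv_lt.
have cq m i : m \in msupp q -> (m i)%:R = 0 :> K.
  move=> mq; have [->//|mi] := posnP (m i).
  have := congr1 (mcoeff (m - U_(i))%MM) (dq i).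
  have le_m : (U_(i) <= m)%MM by rewrite lep1mP -lt0n.
  rewrite mcoeff_deriv submK // mnmBE mnm1E eqxx subn1 prednK // mcoeff0.
  move/eqP; rewrite -[X in X == 0]mulr_natl mulf_eq0 => /orP[/eqP //|].
  by rewrite mcoeff_eq0 mq.
have sq : (1 < msize q)%N.
  rewrite ltnNge; apply/negP => /msize1_polyC E; apply: (prime_ideal1 Pp).
  have c0 : q@_0 != 0 by apply: contraNneq q0 => c0; rewrite E c0 mpolyC0.
  have := prime_idealM Pp (q@_0)^-1%:MP Pq.
  by rewrite {2}E -mpolyCM mulVf.
(* All exponents of the nonconstant [q] are zero in [K], so the characteristic is positive. *)
have [r chr] : exists r, r \in [pchar K].
  have [m mq m0] : exists2 m, m \in msupp q & m != 0%MM.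
    by exists (mlead q); rewrite ?mlead_supp // -mdeg_eq0 -lt0n -ltnS mlead_deg.
  have [i mi] : exists i, m i != 0%N.
    apply: contrapT => no; case/eqP: m0; apply/mnmP => i; rewrite mnm0E.
    by apply/eqP; apply: contrapT => /negP mi; apply: no; exists i.
  apply: (@natf0_pchar K (m i)); rewrite ?lt0n //.
  by rewrite (cq m i mq).
have r1 : (1 < r)%N by apply/prime_gt1/(pcharf_prime chr).
have chr' : r \in [pchar {mpoly K[N]}].
  rewrite inE (pcharf_prime chr) /= -mpolyC_nat (pcharf0 chr) mpolyC0 //.
pose root (m : 'X_{1..N}) := [multinom (m i %/ r)%N | i < N].
have rootE m : m \in msupp q -> m = (root m *+ r)%MM.
  move=> mq; apply/mnmP => i; rewrite mulmnE mnmE divnK //.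
  by rewrite (dvdn_pcharf chr) cq.
pose k := size (msupp q); pose mon (i : 'I_k) := nth 0%MM (msupp q) i.
have mon_in (i : 'I_k) : mon i \in msupp q by apply: mem_nth.
pose Q (x : {mpoly K[N]}) := x \in mpoly_in B /\ (msize x < msize q)%N.
have [|||k' [c' [m' [Qm' E ind]]]] := @semilinear_independent_sum K K
  (pFrobenius_aut chr) {mpoly K[N]} {mpoly K[N]} (pFrobenius_aut chr') Q k
  (fun i => q@_(mon i)) (fun i => 'X_[root (mon i)]).
- by move=> a x; rewrite /= !pFrobenius_autE exprZn.
- move=> a x y [xB sx] [yB sy]; split; first by rewrite rpredD ?mpoly_inZ.
  apply: leq_ltn_trans (msizeD_le _ _) _; rewrite gtn_max sx /=.
  exact: leq_ltn_trans (msizeZ_le _ _) sy.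
- move=> i; split.
    have /mpoly_inP h := mpoly_in_monom qB (mon_in i).
    apply/mpoly_inP => m; rewrite msuppX inE => /eqP -> j jB.
    by rewrite mnmE (h (mon i)) ?msuppX ?inE ?eqxx // div0n.
  rewrite msizeX; have := msize_mdeg_lt (mon_in i).
  rewrite {1}(rootE _ (mon_in i)) mdegMn.
  move: (mdeg (root (mon i))) (msize q) sq r1 => a b.
  by case: a => [//|a] _ r1; apply: leq_ltn_trans; rewrite mulnC ltn_Pmull.
have {}E : q = \sum_i c' i *: m' i ^+ r.
  rewrite -[RHS](_ : \sum_i c' i *: pFrobenius_aut chr' (m' i) = _); last first.
    by apply: eq_bigr => i _; rewrite pFrobenius_autE.
  rewrite -E {1}(mpolyE q) (big_nth 0%MM) big_mkord; apply: eq_bigr => i _.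
  by rewrite /= pFrobenius_autE mpolyXn -rootE.
have [i mi] : exists i, m' i != 0.
  apply: contrapT => no; case/negP: q0; rewrite E big1 // => i _.
  have -> : m' i = 0.
    by apply/eqP; apply: contrapT => /negP h; apply: no; exists i.
  by rewrite expr0n (gtn_eqF (ltnW r1)) scaler0.
have nP : ~ P (m' i).
  move=> Pm; have [mB sm] := Qm' i.
  by have := qmin _ (And3 mB Pm mi); rewrite leqNgt sm.
(* At a point of [S] where [q] vanishes but [m' i] does not, the coefficients [c'] satisfy a
   nontrivial relation over the [r]-th powers. *)
have [|v [_ qv miv]] := dP [:: q] _ _ nP; first by move=> p; rewrite inE => /eqP ->.
case/negP: miv; apply/eqP; apply: (ind (fun i => (m' i).@[v])).
rewrite -[RHS](qv q) ?inE // [in RHS]E (raddf_sum (meval v)).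
by apply: eq_bigr => l _; rewrite /= mevalZ rmorphXn /= pFrobenius_autE.
Qed.

Lemma mderiv_coefs_in P i q : prime_ideal P ->
  coefs_in P (main_var i q) -> P q^`M(i).
Proof.
move=> Pp cq; rewrite -(main_varK i q) mderiv_horner.
apply: (prime_ideal_sum Pp) => e _; apply: (prime_idealD Pp); last first.
  exact: (prime_idealMr Pp).
rewrite (@mderiv_mpoly_in _ _ (setT :\ i)) ?mul0r; first exact: (prime_ideal0 Pp).
  by apply: (polyOverP (main_var_over i (mpoly_inT q))).
by rewrite setD11.
Qed.

(** A relation [q'] free of [X_i] lies in [P1] and makes [X_k] algebraic over [J] modulo [P1]. As
    [q] is outside [P1], eliminating [X_k] from it gives an element of [P] in the coordinates [J]
    that is nonzero, against independence. *)
Lemma exchange P J k i q : prime_ideal P -> indep_mod P J -> k \notin J -> i \in J ->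
  q \in mpoly_in (k |: J) -> P q -> ~ P q^`M(i) -> indep_mod P ((k |: J) :\ i).
Proof.
move=> Pp iJ kJ ij qJ Pq nq q' q'J Pq'; apply/eqP; apply: contrapT => /negP q'0.
pose P1 p := coefs_in P (main_var i p).
have P1p : prime_ideal P1 := prime_ideal_main_var i Pp.
have P1P p : P1 p -> P p by move=> h; rewrite -(main_varK i p); apply: (coefs_in_horner Pp).
have [||b [u [bJ nb Pb]]] := @eliminate_var _ _ P1 J k q P1p kJ _ qJ.
- exists q'; split.
  + by apply: mpoly_inS q'J; apply: subsetDl.
  + move=> e; rewrite (main_var_in q'J) ?setD11 // coefC.
    by case: (e == _) => //; apply: (prime_ideal0 Pp).
  move=> cq'; have := main_var_neq0 k q'0; case/negP; apply/eqP/polyP => e.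
  rewrite coef0; apply: iJ; last exact: P1P.
  apply: (mpoly_inS _ (polyOverP (main_var_over k q'J) e)).
  by apply/subsetP => x; rewrite !inE => /andP[/negbTE ->] /andP[_].
- by move=> h; apply: nq; apply: mderiv_coefs_in.
apply: nb; suff -> : b = 0 by apply: (prime_ideal0 P1p).
apply: iJ => //; rewrite -(subrK (q * u) b); apply: (prime_idealD Pp); first exact: P1P.
exact: (prime_idealMr Pp).
Qed.

(** Over the fraction field modulo [P], the differentials of the [ps] span those of the elements of
    [P] in the variables [B]; [D] is a common denominator. *)
Definition differentials_spanned P B s (ps : 'I_s -> {mpoly K[N]}) :=
  (forall i, ps i \in mpoly_in B /\ P (ps i)) /\
  forall G, G \in mpoly_in B -> P G -> exists D C, ~ P D /\
    forall l, P (D * G^`M(l) - \sum_i C i * (ps i)^`M(l)).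

Lemma differentials_spanned_fin P B s (ps : 'I_s -> {mpoly K[N]}) (X : finType)
    (G : X -> {mpoly K[N]}) : prime_ideal P -> differentials_spanned P B ps ->
  (forall x, G x \in mpoly_in B /\ P (G x)) ->
  exists D C, ~ P D /\
    forall x l, P (D * (G x)^`M(l) - \sum_i C x i * (ps i)^`M(l)).
Proof.
move=> Pp [_ sp] hG.
have /choice[DC hDC] x : exists DC : {mpoly K[N]} * ('I_s -> {mpoly K[N]}), ~ P DC.1 /\
    forall l, P (DC.1 * (G x)^`M(l) - \sum_i DC.2 i * (ps i)^`M(l)).
  by have [GB PG] := hG x; have [D [C h]] := sp _ GB PG; exists (D, C).
pose rest x := \prod_(y | y != x) (DC y).1.
exists (\prod_x (DC x).1), (fun x i => rest x * (DC x).2 i); split.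
  by apply: (nprime_ideal_prod Pp) => x _; have [] := hDC x.
move=> x l; have [_ /(_ l) h] := hDC x.
have -> : \prod_x (DC x).1 = rest x * (DC x).1 by rewrite (bigD1 x) //= mulrC.
have -> : \sum_i rest x * (DC x).2 i * (ps i)^`M(l) =
   rest x * \sum_i (DC x).2 i * (ps i)^`M(l).
  by rewrite mulr_sumr; apply: eq_bigr => i _; rewrite mulrA.
by rewrite -mulrA -mulrBr; apply: (prime_idealM Pp).
Qed.

(** Pseudo-division by the minimal polynomial of [X_j] expresses every differential through that of
    [M] and, for the coefficients of the remainder, those of the [ps]. As the [j]-derivative of [p]
    is outside [P], the differential of [p] can replace that of [M]. *)
Lemma differentials_spanned_step P A j s (ps : 'I_s -> {mpoly K[N]}) p :
  prime_ideal P -> j \notin A -> differentials_spanned P A ps ->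
  p \in mpoly_in (j |: A) -> P p -> ~ P p^`M(j) ->
  differentials_spanned P (j |: A) (fun i => oapp ps p (unlift ord0 i)).
Proof.
move=> Pp jA sp pA Pp' np; have [psA _] := sp.
have [mu [muS mux lmu mumin]] : exists mu : {poly {mpoly K[N]}},
  [/\ mu \is a polyOver (mpoly_in A), P mu.['X_j], ~ P (lead_coef mu) &
   forall G, G \is a polyOver (mpoly_in A) -> (size G < size mu)%N -> P G.['X_j] ->
     coefs_in P G].
  apply: (minimal_poly Pp); apply: algebraic_alg_mod => //; exists p; split=> //.
  by move=> h; apply: np; apply: mderiv_coefs_in.
have mu0 : mu != 0.
  by apply/eqP => mu0; apply: lmu; rewrite mu0 lead_coef0; apply: (prime_ideal0 Pp).
set M := mu.['X_j] in mux.
have key G : G \in mpoly_in (j |: A) -> P G -> exists D C Q, [/\ ~ P D,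
    forall l, P (D * G^`M(l) - (Q * M^`M(l) + \sum_i C i * (ps i)^`M(l))) &
    ~ P G^`M(j) -> ~ P Q].
  move=> GA PG; have HA := main_var_over_setU jA GA.
  have [k [Q [rem [QS remS E lt_r _]]]] := pseudo_division HA muS mu0.
  set a := lead_coef mu ^+ k in E.
  have na : ~ P a by apply: (nprime_idealX Pp).
  have EG : a * G = Q.['X_j] * M + rem.['X_j].
    by rewrite -hornerM -hornerD -E hornerZ main_varK.
  have crem : coefs_in P rem.
    apply: mumin => //.
    have -> : rem.['X_j] = a * G - Q.['X_j] * M by rewrite EG addrC addKr.
    by apply: (prime_idealB Pp); apply: (prime_idealM Pp).
  have [|D [C [nD hD]]] := @differentials_spanned_fin P A s ps 'I_(size rem)
       (fun e => rem`_e) Pp sp.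
    by move=> e; split; [apply: (polyOverP remS) | apply: crem].
  exists (D * a), (fun i => \sum_e C e i * 'X_j ^+ e), (D * Q.['X_j]).
  have main l : P (D * a * G^`M(l) - (D * Q.['X_j] * M^`M(l) +
      \sum_i (\sum_e C e i * 'X_j ^+ e) * (ps i)^`M(l))).
    have /(congr1 (mderiv l)) := EG; rewrite mderivD !mderivM (mderiv_horner j rem) => Ed.
    have -> : \sum_i (\sum_e C e i * 'X_j ^+ e) * (ps i)^`M(l) =
        \sum_(e < size rem) 'X_j ^+ e * \sum_i C e i * (ps i)^`M(l).
      under eq_bigr do rewrite mulr_suml.
      rewrite exchange_big /=; apply: eq_bigr => e _; rewrite mulr_sumr.
      by apply: eq_bigr => i _; rewrite mulrAC mulrC.
    rewrite big_split /= in Ed.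
    set U := \sum_(e < size rem) rem`_e^`M(l) * 'X_j ^+ e in Ed.
    set W := \sum_(e < size rem) rem`_e * ('X_j ^+ e)^`M(l) in Ed.
    have PW : P W.
      by apply: (prime_ideal_sum Pp) => e _; apply: (prime_idealMr Pp).
    set V := \sum_(e < size rem) _.
    have PUV : P (D * U - V).
      rewrite /U /V mulr_sumr -sumrB; apply: (prime_ideal_sum Pp) => e _.
      rewrite mulrA [D * _ * _]mulrC -mulrBr; apply: (prime_idealM Pp); exact: hD.
    have -> : D * a * G^`M(l) - (D * Q.['X_j] * M^`M(l) + V) =
        D * W + (D * Q.['X_j]^`M(l)) * M - (D * a^`M(l)) * G + (D * U - V).
      have -> : D * a * G^`M(l) = D * (a^`M(l) * G + a * G^`M(l)) - (D * a^`M(l)) * G.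
        by rewrite mulrDr !mulrA addrC addKr.
      by rewrite Ed; ring.
    apply: (prime_idealD Pp) PUV; apply: (prime_idealB Pp); last exact: (prime_idealM Pp).
    by apply: (prime_idealD Pp); apply: (prime_idealM Pp).
  split=> //; first exact: (nprime_idealM Pp).
  (* The [ps] are free of [X_j], so in direction [j] only the multiple of the differential of [M]
     remains. *)
  move=> nG PQ; apply: (nprime_idealM Pp (nprime_idealM Pp nD na) nG).
  have := main j; rewrite [X in _ - (_ + X)]big1 ?addr0 => [h|i _]; last first.
    by rewrite (mderiv_mpoly_in _ jA) ?mulr0 //; have [] := psA i.
  rewrite -[D * a * _](subrK (D * Q.['X_j] * M^`M(j))).
  by apply: (prime_idealD Pp) h _; apply: (prime_idealMr Pp).
split=> [i|G GA PG].
  case: unliftP => [i' _|_] //=.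
  have [psi Ppsi] := psA i'; split=> //; apply: mpoly_inS psi; exact: subsetUr.
have [Dg [Cg [Qg [nDg hg _]]]] := key G GA PG.
have [Dp [Cp [Qp [nDp hp /(_ np) nQp]]]] := key p pA Pp'.
(* Cross-multiplying the expressions for [G] and [p] cancels the differential of [M]; index 0
   carries [p]. *)
exists (Qp * Dg), (fun i => oapp (fun i' => Qp * Cg i' - Qg * Cp i') (Qg * Dp) (unlift ord0 i)).
split=> [|l]; first exact: (nprime_idealM Pp).
rewrite big_ord_recl unlift_none /=.
have -> : \sum_(i < s) oapp (fun i' => Qp * Cg i' - Qg * Cp i') (Qg * Dp)
      (unlift ord0 (lift ord0 i)) * (oapp ps p (unlift ord0 (lift ord0 i)))^`M(l) =
   Qp * (\sum_i Cg i * (ps i)^`M(l)) - Qg * (\sum_i Cp i * (ps i)^`M(l)).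
  rewrite !mulr_sumr -sumrB; apply: eq_bigr => i _.
  by rewrite liftK /= mulrBl !mulrA.
set Tg := \sum_i Cg i * _; set Tp := \sum_i Cp i * _.
have -> : Qp * Dg * G^`M(l) - (Qg * Dp * p^`M(l) + (Qp * Tg - Qg * Tp)) =
   Qp * (Dg * G^`M(l) - (Qg * M^`M(l) + Tg)) - Qg * (Dp * p^`M(l) - (Qp * M^`M(l) + Tp)).
  by ring.
by apply: (prime_idealB Pp); apply: (prime_idealM Pp); [apply: hg | apply: hp].
Qed.

(** Induction on the number of variables of [B] beyond a basis [J]. A separating relation [q] on
    [k |: J] has a derivative in some [X_i] outside [P]; by exchange [i] can be removed, and [q]
    accounts for putting [X_i] back. *)
Lemma separating_differentials (S : ('I_N -> K) -> Prop) P m : prime_ideal P ->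
  dense_for S P -> (forall B, indep_mod P B -> (#|B| <= m)%N) ->
  forall n B J, J \subset B -> #|J| = m -> indep_mod P J -> #|B| = (m + n)%N ->
  exists ps : 'I_n -> {mpoly K[N]}, differentials_spanned P B ps.
Proof.
move=> Pp dP mmax; elim=> [|n IH] B J sJB cJ iJ cB.
  have EB : J = B by apply/eqP; rewrite eqEcard sJB cB cJ addn0 leqnn.
  exists (fun=> 0); split=> [[]//|G GB PG].
  rewrite EB in iJ; exists 1, (fun=> 0); split; first exact: (prime_ideal1 Pp).
  by move=> l; rewrite (iJ G) // raddf0 mulr0 big_ord0 subr0; apply: (prime_ideal0 Pp).
have [k kB kJ] : exists2 k, k \in B & k \notin J.
  apply/subsetPn; apply/negP => /subset_leq_card.
  by rewrite cB cJ addnS ltnNge leq_addr.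
have [q [i [qJ Pq nq]]] : exists q i, [/\ q \in mpoly_in (k |: J), P q & ~ P q^`M(i)].
  apply: (separating_relation Pp dP) => /mmax.
  by rewrite cardsU1 kJ cJ add1n ltnn.
have ikJ : i \in k |: J.
  by apply: contra_notT nq => iJ'; rewrite (mderiv_mpoly_in qJ iJ'); apply: (prime_ideal0 Pp).
have kJB : k |: J \subset B by rewrite subUset sub1set kB.
have iB : i \in B by apply: (subsetP kJB).
have iJ' : indep_mod P ((k |: J) :\ i).
  move: ikJ; rewrite !inE => /orP[/eqP ->|iJi]; first by rewrite setU1K.
  exact: exchange Pq nq.
have cJ' : #|(k |: J) :\ i| = m.
  by have := cardsD1 i (k |: J); rewrite ikJ cardsU1 kJ cJ !add1n => -[].
have [||ps hps] := IH (B :\ i) ((k |: J) :\ i) _ cJ' iJ'.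
- exact: setSD.
- by have := cardsD1 i B; rewrite iB cB addnS add1n => -[].
exists (fun l => oapp ps q (unlift ord0 l)).
rewrite -(setD1K iB); apply: differentials_spanned_step => //; first by rewrite setD11.
by rewrite setD1K //; apply: mpoly_inS qJ.
Qed.

End Separability.

(** * Iterated derivatives *)

Section IteratedDerivatives.
Variables (K : fieldType) (N : nat) (I : finType) (T : I -> finType).
Variable var : forall i, T i -> 'I_N.
Local Notation Lam := {dffun forall i, T i}.
Implicit Types (l : Lam) (A B : {set I}).

Definition agree A l l' := forall i, i \in A -> l i = l' i.

(** The order of differentiation taking one derivative in each block of [A], in the direction
    selected by [l]. *)
Definition dmon l A : 'X_{1..N} := (\sum_(i in A) U_(var (l i)))%MM.

Lemma agreeS A B l l' : A \subset B -> agree B l l' -> agree A l l'.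
Proof. by move=> /subsetP sAB h i /sAB; apply: h. Qed.

Lemma eq_dmon A l l' : agree A l l' -> dmon l A = dmon l' A.
Proof. by move=> h; apply: eq_bigr => i /h ->. Qed.

Lemma mderivm_dmonU A t l (p : {mpoly K[N]}) : t \notin A ->
  p^`M[dmon l (t |: A)] = p^`M[dmon l A]^`M(var (l t)).
Proof.
by move=> tA; rewrite /dmon big_setU1 //= addmC mderivmDm mderivmU1m.
Qed.

Lemma big_subsets_setU1 (V : zmodType) t B (F : {set I} -> V) : t \notin B ->
  \sum_(A : {set I} | (A \subset t |: B) && (A != set0)) F A =
  F [set t] + \sum_(A : {set I} | (A \subset B) && (A != set0)) (F (t |: A) + F A).
Proof.
move=> tB; rewrite big_split /= (bigID (fun A : {set I} => t \in A)) /= addrA.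
congr (_ + _); last first.
  apply: eq_bigl => A; apply/andP/andP.
    case=> /andP[sA A0] tA; split=> //; apply/subsetP => x xA.
    have := subsetP sA x xA; rewrite !inE => /orP[/eqP xt|//].
    by rewrite -xt xA in tA.
  case=> sA A0; split; last by apply: contra tB; apply: (subsetP sA).
  by rewrite A0 andbT; apply: subset_trans sA (subsetUr _ _).
transitivity (\sum_(A : {set I} | A \subset B) F (t |: A)).
  rewrite (reindex_onto (fun A : {set I} => t |: A) (fun A => A :\ t)) /=; last first.
    by move=> A /andP[_ tA]; rewrite setD1K.
  apply: eq_bigl => A; rewrite setU11 andbT.
  apply/idP/idP => [/andP[/andP[sA _] /eqP E]|sA].
    rewrite -E; apply/subsetP => x; rewrite inE => /andP[xt xA].
    by have := subsetP sA x xA; rewrite !inE in xt *; rewrite (negbTE xt).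
  have tA : t \notin A by apply: contra tB; apply: (subsetP sA).
  rewrite setU1K // eqxx setUS //= andbT.
  by apply/set0Pn; exists t; rewrite setU11.
by rewrite (bigD1 set0) ?sub0set //= setU0.
Qed.

(* Differentiating [G] along the blocks of [B], one block at a time: modulo [P] *)
(* each new derivative is rewritten through the differentials of the [ps].      *)
Lemma iterated_derivatives (P : {mpoly K[N]} -> Prop) s (ps : 'I_s -> {mpoly K[N]}) :
  prime_ideal P -> differentials_spanned P [set: 'I_N] ps ->
  forall B G, P G -> exists d (h : 'I_s -> {set I} -> Lam -> {mpoly K[N]}),
  [/\ ~ P d, forall i A l l', agree A l l' -> h i A l = h i A l' &
   forall l, P (d * G^`M[dmon l B] -
     \sum_(A : {set I} | (A \subset B) && (A != set0))
       \sum_i (ps i)^`M[dmon l A] * h i (B :\: A) l)].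
Proof.
move=> Pp sp B G PG; have [n] := ubnP #|B|; elim: n B => // n IH B lt_n.
have [->|[t tB]] := set_0Vmem B.
  exists 1, (fun _ _ _ => 0); split=> //; first exact: (prime_ideal1 Pp).
  move=> l; rewrite big1; last first.
    by move=> A _; rewrite big1 // => i _; rewrite mulr0.
  by rewrite subr0 mul1r /dmon big_set0 mderivm0m.
pose B0 := B :\ t; have tB0 : t \notin B0 by rewrite setD11.
have EB : B = t |: B0 by rewrite setD1K.
have [|d [h [nd hag hP]]] := IH B0; first by rewrite (cardsD1 t) tB in lt_n.
pose X l : {mpoly K[N]} := \sum_(A : {set I} | (A \subset B0) && (A != set0))
       \sum_i (ps i)^`M[dmon l A] * h i (B0 :\: A) l.
pose E l : {mpoly K[N]} := d * G^`M[dmon l B0] - X l.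
have [|D [C0 [nD hC0]]] := @differentials_spanned_fin _ _ P _ s ps Lam E Pp sp.
  by move=> l; split; [apply: mpoly_inT | apply: hP].
(* The coefficients are chosen as a function of the polynomial [E l], not of [l], so that they
   depend only on the blocks of [B0]. *)
have /choice[c hc] (H : {mpoly K[N]}) : exists c : 'I_s -> {mpoly K[N]},
    (exists l, H = E l) -> forall x, P (D * H^`M(x) - \sum_i c i * (ps i)^`M(x)).
  have [[l ->]|no] := EM (exists l, H = E l); last by exists (fun=> 0).
  by exists (C0 l) => _; apply: hC0.
(* Three origins, by the complement [R] of [A] in [B]: if [t] is in [R], the new derivative fell on
   [h] or on [d]; [R = B0] is the new term [A = [set t]]; otherwise it fell on the derivative of
   [ps]. *)
pose h' (i : 'I_s) (R : {set I}) (l : Lam) : {mpoly K[N]} := if t \in R then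
    D * d * (h i (R :\ t) l)^`M(var (l t)) - D * d^`M(var (l t)) * h i (R :\ t) l
  else if R == B0 then d * c (E l) i else D * d * h i R l.
have Eag l l' : agree B0 l l' -> E l = E l'.
  move=> ag; rewrite /E /X (eq_dmon ag); congr (_ - _).
  apply: eq_bigr => A /andP[sA _]; apply: eq_bigr => i _.
  rewrite (eq_dmon (agreeS sA ag)) (hag i _ l l') //.
  exact: agreeS (subsetDl _ _) ag.
exists (D * d * d), h'; split.
- by do 2 apply: (nprime_idealM Pp) => //.
- move=> i R l l' ag; rewrite /h'; case: ifP => tR.
    have agt : agree (R :\ t) l l' by apply: agreeS (subsetDl _ _) ag.
    by rewrite (hag i _ _ _ agt) ag.
  case: eqP => [ER|_]; last by rewrite (hag i _ _ _ ag).
  by rewrite (Eag l l') -?ER.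
move=> l; set x := var (l t).
have dX : (X l)^`M(x) = \sum_(A : {set I} | (A \subset B0) && (A != set0))
    \sum_i ((ps i)^`M[dmon l A]^`M(x) * h i (B0 :\: A) l +
            (ps i)^`M[dmon l A] * (h i (B0 :\: A) l)^`M(x)).
  rewrite raddf_sum; apply: eq_bigr => A _; rewrite /= raddf_sum; apply: eq_bigr => i _.
  by rewrite /= mderivM.
have sumE : \sum_(A : {set I} | (A \subset B) && (A != set0))
     \sum_i (ps i)^`M[dmon l A] * h' i (B :\: A) l =
   d * (\sum_i c (E l) i * (ps i)^`M(x)) + (D * d * (X l)^`M(x) - D * d^`M(x) * X l).
  rewrite EB big_subsets_setU1 //; congr (_ + _).
    rewrite setU1K // mulr_sumr; apply: eq_bigr => i _.
    rewrite /h' (negbTE tB0) eqxx /dmon big_set1 mderivmU1m mulrC.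
    by rewrite -mulrA.
  have [e1 e1E] : exists e1, e1 = D * d^`M(x) by exists (D * d^`M(x)).
  rewrite dX /X -e1E !mulr_sumr -sumrB; apply: eq_bigr => A /andP[sA A0].
  rewrite -big_split !mulr_sumr -sumrB; apply: eq_bigr => i _ /=.
  have tA : t \notin A by apply: contra tB0; apply: (subsetP sA).
  have -> : (t |: B0) :\: (t |: A) = B0 :\: A.
    apply/setP => y; rewrite in_setD in_setU1 in_setD in_setU1.
    by case: eqP => [->|//] /=; rewrite (negbTE tB0) andbF.
  have -> : (t |: B0) :\: A = t |: (B0 :\: A).
    by rewrite setDUl; congr (_ :|: _); apply/setDidPl; rewrite disjoints1.
  have tBA : t \notin B0 :\: A by rewrite in_setD (negbTE tB0) andbF.
  rewrite /h' setU11 setU1K //.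
  rewrite (negbTE tBA).
  have -> : (B0 :\: A == B0) = false.
    apply/negP => /eqP/setDidPl dis.
    have /set0Pn[y yA] := A0.
    have := disjointFl dis yA; by rewrite (subsetP sA).
  rewrite mderivm_dmonU // -/x -e1E; ring.
have EG : G^`M[dmon l B] = G^`M[dmon l B0]^`M(x) by rewrite EB mderivm_dmonU.
rewrite sumE EG.
have -> : D * d * d * G^`M[dmon l B0]^`M(x) - (d * (\sum_i c (E l) i * (ps i)^`M(x)) +
     (D * d * (X l)^`M(x) - D * d^`M(x) * X l)) =
   d * (D * (E l)^`M(x) - \sum_i c (E l) i * (ps i)^`M(x)) - D * d^`M(x) * E l.
  by rewrite {1}/E mderivB mderivM /E; ring.
apply: (prime_idealB Pp); apply: (prime_idealM Pp); last exact: hP.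
by apply: hc; exists l.
Qed.

End IteratedDerivatives.

(** * Multilinear functions *)

Section Multilinear.
Variables (K : fieldType) (d : nat) (n : 'I_d -> nat).
Implicit Types (f g : tensor K n -> K) (x y z : tensor K n) (A : {set 'I_d}).
Local Notation Lam := {dffun forall i : 'I_d, 'I_(n i)}.

Definition tensor_ext f := forall x y, (forall i k, x i k = y i k) -> f x = f y.

Definition unit_vector (i : 'I_d) (k0 : 'I_(n i)) : 'I_(n i) -> K :=
  fun k => (k == k0)%:R.

Definition unit_tensor (l : forall i : 'I_d, 'I_(n i)) : tensor K n :=
  fun i => unit_vector (l i).

Lemma multilinear_on_ext A f : multilinear_on A f -> tensor_ext f.
Proof. by move=> [h _] x y xy; apply: h => i _; apply: xy. Qed.

Lemma lin_in_block_expand t f x : tensor_ext f -> lin_in_block t f ->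
  f x = \sum_k x t k * f (dfwith x (unit_vector k)).
Proof.
move=> fext lin; pose phi (y : 'I_(n t) -> K) := f (dfwith x y).
have phi_lin (a : K) (y1 y2 y3 : 'I_(n t) -> K) : (forall k, y3 k = a * y1 k + y2 k) ->
    phi y3 = a * phi y1 + phi y2.
  move=> h; apply: lin => [j jt k|k]; last by rewrite !dfwith_in.
  by rewrite !dfwith_out // eq_sym.
have phi0 : phi (fun=> 0) = 0.
  have := @phi_lin 1 (fun=> 0) (fun=> 0) (fun=> 0) (fun=> ltac:(by rewrite mulr0 addr0)).
  by rewrite mul1r -[LHS]add0r => /addIr <-.
have phi_seq (s : seq 'I_(n t)) : uniq s ->
    phi (fun k => if k \in s then x t k else 0) = \sum_(k <- s) x t k * phi (unit_vector k).
  elim: s => [_|k s IH /= /andP[ks us]]; first by rewrite big_nil.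
  rewrite big_cons -IH //; apply: phi_lin => k'.
  rewrite inE /unit_vector; case: eqP => [->|_] /=; last by rewrite mulr0 add0r.
  by rewrite (negbTE ks) mulr1 addr0.
rewrite -(phi_seq _ (index_enum_uniq _)); apply: fext => i k.
have [it|it] := eqVneq i t; last by rewrite dfwith_out // eq_sym.
by subst i; rewrite dfwith_in mem_index_enum.
Qed.

(** The blocks of [x] are expanded one at a time; [A] holds those that may not yet be basis
    vectors. *)
Lemma multilinear_eq f g : multilinear f -> multilinear g ->
  (forall l, f (unit_tensor l) = g (unit_tensor l)) -> forall x, f x = g x.
Proof.
move=> mf mg fg x; have [fe ge] := (multilinear_on_ext mf, multilinear_on_ext mg).
suff: forall A x, (forall i, i \notin A -> exists k0, forall k, x i k = unit_vector k0 k) ->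
    f x = g x.
  by move=> /(_ setT x); apply=> i; rewrite inE.
move=> {x} A; have [m] := ubnP #|A|; elim: m A => // m IH A lt_m x hx.
have [A0|[t tA]] := set_0Vmem A.
  have /fin_all_exists[l hl] i : exists k0, forall k, x i k = unit_vector k0 k.
    by apply: hx; rewrite A0 inE.
  by rewrite (fe x (unit_tensor l)) ?(ge x (unit_tensor l)).
rewrite (lin_in_block_expand x fe (mf.2 t (in_setT t))).
rewrite (lin_in_block_expand x ge (mg.2 t (in_setT t))).
apply: eq_bigr => k _; congr (_ * _); apply: (IH (A :\ t)).
  by rewrite (cardsD1 t) tA in lt_m.
move=> i; have [->|it] := eqVneq i t; first by exists k => k'; rewrite dfwith_in.
by rewrite dfwith_out 1?eq_sym // => iA; apply: hx; move: iA; rewrite !inE it.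
Qed.

Lemma multilinear_mul A f g : multilinear_on A f -> multilinear_on (~: A) g ->
  multilinear (fun x => f x * g x).
Proof.
move=> mf mg; split=> [x y xy|i _ a x y z xyz zi].
  by rewrite (multilinear_on_ext mf (y := y)) ?(multilinear_on_ext mg (y := y)) // => i k;
     apply: xy; rewrite inE.
have off (B : {set 'I_d}) : i \notin B -> forall j, j \in B ->
    (forall k, x j k = z j k) /\ (forall k, y j k = z j k).
  move=> iB j jB; have ji : j != i by apply: contraNneq iB => <-.
  by split=> k; have [] := xyz j ji k.
have [iA|iA] := boolP (i \in A).
  have offA := off (~: A) ltac:(by rewrite inE iA).
  rewrite (mf.2 i iA a x y z) // (mg.1 x z) ?(mg.1 y z) => [|j /offA[]|j /offA[]] //.
  by rewrite mulrDl mulrA.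
rewrite (mg.2 i _ a x y z) ?inE // (mf.1 x z) ?(mf.1 y z) => [|j /(off _ iA)[]|j /(off _ iA)[]] //.
by rewrite mulrDr mulrCA.
Qed.

Lemma multilinear_sum (X : Type) (r : seq X) (C : pred X) (F : X -> tensor K n -> K) :
  (forall u, C u -> multilinear (F u)) -> multilinear (fun x => \sum_(u <- r | C u) F u x).
Proof.
move=> mF; split=> [x y xy|i iT a x y z xyz zi].
  by apply: eq_bigr => u /mF[h _]; apply: h.
rewrite mulr_sumr -big_split; apply: eq_bigr => u /mF[_ h] /=.
exact: (h i iT a x y z xyz zi).
Qed.

Lemma multilinear0 : multilinear (fun _ : tensor K n => 0 : K).
Proof. by split=> [//|i _ a x y z _ _]; rewrite mulr0 addr0. Qed.

Variable l0 : Lam.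

(* Off [A] the multi-index [l] is frozen at [l0], so that each term occurs once. *)
Definition multilinear_ext A (a : Lam -> K) : tensor K n -> K := fun x =>
  \sum_(l : Lam | [forall i, (i \notin A) ==> (l i == l0 i)]) a l * \prod_(i in A) x i (l i).

Lemma multilinear_ext_on A a : multilinear_on A (multilinear_ext A a).
Proof.
split=> [x y xy|t tA b x y z xyz zt].
  by apply: eq_bigr => l _; congr (_ * _); apply: eq_bigr => i iA; apply: xy.
rewrite /multilinear_ext mulr_sumr -big_split; apply: eq_bigr => l _ /=.
rewrite !(bigD1 t tA) /= zt.
have -> : \prod_(i in A | i != t) x i (l i) = \prod_(i in A | i != t) z i (l i).
  by apply: eq_bigr => i /andP[_ it]; have [] := xyz i it (l i).
have -> : \prod_(i in A | i != t) y i (l i) = \prod_(i in A | i != t) z i (l i).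
  by apply: eq_bigr => i /andP[_ it]; have [] := xyz i it (l i).
by ring.
Qed.

Lemma multilinear_ext_unit A a (l : Lam) :
  (forall l l' : Lam, agree A l l' -> a l = a l') ->
  multilinear_ext A a (unit_tensor l) = a l.
Proof.
move=> aA; pose l1 : Lam := [ffun i => if i \in A then l i else l0 i].
have ag : agree A l1 l by move=> i iA; rewrite ffunE iA.
rewrite /multilinear_ext (bigD1 l1) /=; last first.
  by apply/forallP => i; apply/implyP => /negbTE iA; rewrite ffunE iA.
rewrite big1 => [|i iA]; last by rewrite /unit_tensor /unit_vector (ag i iA) eqxx.
rewrite mulr1 (aA l1 l ag) big1 ?addr0 // => l2 /andP[/forallP h2 ne].
have [i iA nei] : exists2 i, i \in A & l2 i != l i.
  apply: contrapT => no; case/eqP: ne; apply/ffunP => i; rewrite ffunE.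
  case: ifPn => iA; last by apply/eqP; apply: (implyP (h2 i)).
  by apply/eqP; apply: contrapT => /negP h; apply: no; exists i.
by rewrite (bigD1 i iA) /= /unit_tensor /unit_vector (negbTE nei) mul0r mulr0.
Qed.

End Multilinear.

(** Functions of partition rank one are nonzero, so the vanishing products are discarded; hence only
    a bound on the number of terms. *)
Lemma pr_le_sum (K : fieldType) (d : nat) (n : 'I_d -> nat) (X : finType) (C : pred X)
    (F : X -> tensor K n -> K) f :
  (forall u, C u -> exists (A : {set 'I_d}) (g h : tensor K n -> K),
     [/\ A != set0, A != setT, multilinear_on A g, multilinear_on (~: A) h &
      forall x, F u x = g x * h x]) ->
  (forall x, f x = \sum_(u | C u) F u x) -> exists2 r, (r <= #|C|)%N & pr_le f r.
Proof.
move=> hF fE; pose nz u := C u && `[< exists x, F u x != 0 >].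
exists #|nz|; first by apply: subset_leq_card; apply/subsetP => u /andP[].
exists (fun k => F (enum_val k)); split=> [k|x].
  by have /andP[Cu /asboolP nzu] := enum_valP k; split=> //; apply: hF.
rewrite -(big_enum_val (A := nz) (fun u => F u x)) fE.
rewrite [LHS](bigID (fun u => `[< exists x, F u x != 0 >])) /= [X in _ + X]big1 ?addr0.
  by apply: eq_bigl.
move=> u /andP[_ /asboolP no]; apply/eqP; apply: contrapT => /negP h.
by apply: no; exists x.
Qed.

(** * Upper bound on the partition rank *)

Section PartitionRankBound.
Variables (K : fieldType) (d : nat) (n : 'I_d -> nat) (f : tensor K n -> K).
Hypothesis mf : multilinear f.
Variables (lst i0 : 'I_d).
Hypotheses (lstE : val lst = d.-1) (i0lst : i0 != lst).
Local Notation Lam := {dffun forall i : 'I_d, 'I_(n i)}.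
Local Notation N := #|first_coords n|.
Variable l0 : Lam.
Let B : {set 'I_d} := ~: [set lst].

Lemma lt_last i : (val i < d.-1)%N = (i != lst).
Proof.
rewrite -lstE ltn_neqAle -val_eqE; case: eqP => //= _.
by rewrite lstE -ltnS prednK // (leq_trans _ (ltn_ord i)).
Qed.

Fact coord_default_subproof : (val (tag (Tagged (fun i => 'I_(n i)) (l0 i0))) < d.-1)%N.
Proof. by rewrite lt_last. Qed.

(* [coord i k] for [i = lst] is a junk value *)
Definition coord (i : 'I_d) (k : 'I_(n i)) : 'I_N :=
  enum_rank (insubd (exist (fun p : {i : 'I_d & 'I_(n i)} => (val (tag p) < d.-1)%N) _
              coord_default_subproof : first_coords n)
                    (Tagged (fun i => 'I_(n i)) k)).

Lemma coord_rank (p : first_coords n) : coord (tagged (val p)) = enum_rank p.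
Proof.
by case: p => [[i k] hp] /=; congr enum_rank; apply: val_inj; rewrite insubdK.
Qed.

Lemma coord_inj i i' (k : 'I_(n i)) (k' : 'I_(n i')) : i != lst -> i' != lst ->
  coord k = coord k' -> Tagged (fun i => 'I_(n i)) k = Tagged (fun i => 'I_(n i)) k'.
Proof.
move=> il il' /enum_rank_inj /(congr1 val).
by rewrite !insubdK // -topredE /= lt_last.
Qed.

Lemma dmon_coord (l : Lam) i (k : 'I_(n i)) : i != lst ->
  dmon coord l B (coord k) = (l i == k) :> nat.
Proof.
move=> il; rewrite /dmon mnm_sumE (bigD1 i) /=; last by rewrite !inE.
rewrite big1 ?addn0 => [|i' /andP[]]; last first.
  rewrite !inE => il' ne; rewrite mnm1E; case: eqP => // /(coord_inj il' il).
  by move/(congr1 tag) => /= E; rewrite E eqxx in ne.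
rewrite mnm1E; congr nat_of_bool; apply/eqP/eqP => [/(coord_inj il il)|->//].
exact: eq_from_Tagged.
Qed.

(** The function [f] with the basis vector [b] as last argument, as a polynomial in the coordinates
    of the other blocks. *)
Definition slice_poly (b : 'I_(n lst)) : {mpoly K[N]} :=
  \sum_(l : Lam | l lst == b) f (unit_tensor K l) *: 'X_[dmon coord l B].

Lemma multilinear_expand x :
  f x = \sum_(l : Lam) f (unit_tensor K l) * \prod_i x i (l i).
Proof.
have -> : \sum_(l : Lam) f (unit_tensor K l) * \prod_i x i (l i) =
   multilinear_ext l0 setT (fun l => f (unit_tensor K l)) x.
  apply: eq_big => [l|l _]; last by congr (_ * _); apply: eq_bigl => i; rewrite inE.
  by apply/esym/forallP => i; rewrite inE.
apply: (multilinear_eq mf); first exact: multilinear_ext_on.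
move=> l; rewrite -[RHS](_ : multilinear_ext l0 setT (fun l => f (unit_tensor K l))
   (unit_tensor K (finfun l : Lam)) = _).
  rewrite multilinear_ext_unit.
    by apply: (multilinear_on_ext mf) => i k; rewrite /unit_tensor ffunE.
  by move=> l1 l2 ag; suff -> : l1 = l2 by []; apply/ffunP => i; apply: ag; rewrite inE.
apply: (multilinear_on_ext (multilinear_ext_on _ _ _)) => i k.
by rewrite /unit_tensor ffunE.
Qed.

Lemma slice_poly_ZF b v : ZF f v -> (slice_poly b).@[v] = 0.
Proof.
move=> Zv; pose u : tensor K n := dfwith (fun i k => v (coord k)) (unit_vector K b).
rewrite -[RHS](Zv u) => [|p]; last first.
  rewrite /u dfwith_out ?coord_rank // eq_sym -lt_last; exact: valP p.
rewrite multilinear_expand /slice_poly raddf_sum big_mkcond; apply: eq_bigr => l _ /=.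
rewrite (bigD1 lst) //= /u dfwith_in /unit_vector; case: eqP => _; last by rewrite mul0r mulr0.
rewrite mul1r mevalZ /dmon -mprodXE rmorph_prod; congr (_ * _).
apply: eq_big => [i|i]; first by rewrite !inE.
by rewrite !inE => il; rewrite /= mevalXU dfwith_out // eq_sym.
Qed.

(** A slice has degree one in each block, so one derivative per block extracts a single
    coefficient. *)
Lemma slice_poly_deriv (l : Lam) :
  (slice_poly (l lst))^`M[dmon coord l B] = (f (unit_tensor K l))%:MP.
Proof.
have dX (l' : Lam) : l' lst = l lst ->
    ('X_[dmon coord l' B] : {mpoly K[N]})^`M[dmon coord l B] = (l' == l)%:R.
  move=> ll'; rewrite mderivmX; case: eqP => [->|ne].
    have -> : (dmon coord l B - dmon coord l B = 0)%MM.
      by apply/mnmP => j; rewrite mnmBE mnm0E subnn.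
    rewrite mpolyX0 big1 ?scale1r // => j _; rewrite ffactnn.
    suff : (dmon coord l B j <= 1)%N by case: (dmon _ _ _ j) => [|[]].
    have [E|/existsNP[i]] := EM (forall i, i \in B -> coord (l i) != j).
      by rewrite /dmon mnm_sumE big1 // => i /E /negbTE; rewrite mnm1E => ->.
    move/not_implyP => [iB /negP]; rewrite negbK => /eqP <-.
    by rewrite dmon_coord ?eqxx //; move: iB; rewrite !inE.
  have [i il nei] : exists2 i, i != lst & l' i != l i.
    apply: contrapT => no; apply: ne; apply/ffunP => i.
    have [->//|il] := eqVneq i lst.
    by apply/eqP; apply: contrapT => /negP h; apply: no; exists i.
  rewrite (bigD1 (coord (l i))) //= !dmon_coord // eqxx (negbTE nei).
  by rewrite ffactn1 mul0n scale0r.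
rewrite /slice_poly raddf_sum (bigD1 l) //= big1 ?addr0 => [|l' /andP[/eqP ll' ne]].
  by rewrite mderivmZ dX // eqxx -mul_mpolyC mulr1.
by rewrite mderivmZ dX // (negbTE ne) scaler0.
Qed.

Lemma partition_rank_bound J : indep_on (ZF f) J ->
  (forall J', indep_on (ZF f) J' -> (#|J'| <= #|J|)%N) ->
  exists2 r, (r <= (2 ^ d.-1 - 1) * (N - #|J|))%N & pr_le f r.
Proof.
move=> iJ Jmax; set s := (N - #|J|)%N.
have [P [Pp PZ iPJ dP]] := generic_prime iJ.
(* [P] contains the vanishing ideal of [ZF f], so independence modulo [P] implies independence on
   [ZF f]. *)
have Pmax A : indep_mod P A -> (#|A| <= #|J|)%N.
  by move=> iA; apply: Jmax => p pA /PZ; apply: iA.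
have [|ps sp] := @separating_differentials K N (ZF f) P #|J| Pp dP Pmax s
    setT J (subsetT _) erefl iPJ.
  by rewrite cardsT card_ord subnKC // -[X in (_ <= X)%N]card_ord max_card.
have /fin_all_exists[D hD] (b : 'I_(n lst)) : exists D : {mpoly K[N]} *
     ('I_s -> {set 'I_d} -> Lam -> {mpoly K[N]}),
  [/\ ~ P D.1, forall i A l l', agree A l l' -> D.2 i A l = D.2 i A l' &
   forall l, P (D.1 * (slice_poly b)^`M[dmon coord l B] -
     \sum_(A : {set 'I_d} | (A \subset B) && (A != set0))
       \sum_i (ps i)^`M[dmon coord l A] * D.2 i (B :\: A) l)].
  have [|c [h hh]] := iterated_derivatives coord Pp sp B (G := slice_poly b).
    by apply: PZ => v; apply: slice_poly_ZF.
  by exists (c, h).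
pose R (l : Lam) := (D (l lst)).1 * (slice_poly (l lst))^`M[dmon coord l B] -
     \sum_(A : {set 'I_d} | (A \subset B) && (A != set0))
       \sum_i (ps i)^`M[dmon coord l A] * (D (l lst)).2 i (B :\: A) l.
(* By density, at some [K]-point the finitely many congruences modulo [P] become equalities with
   nonzero denominators. *)
have [|v [_ Rv Dv]] := dP [seq R l | l : Lam] (\prod_b (D b).1) _
    (nprime_ideal_prod Pp (fun b _ => let: And3 h _ _ := hD b in h)).
  by move=> p /codomP[l ->]; have [_ _ h] := hD (l lst); apply: h.
have {}Dv b : (D b).1.@[v] != 0.
  move: Dv; rewrite rmorph_prod (bigD1 b) //= mulf_eq0.
  by case/norP.
pose a (i : 'I_s) A (l : Lam) := ((ps i)^`M[dmon coord l A]).@[v].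
pose c (i : 'I_s) (A : {set 'I_d}) (l : Lam) :=
  ((D (l lst)).2 i (B :\: A) l).@[v] / (D (l lst)).1.@[v].
have fE x : f x = \sum_(u : {set 'I_d} * 'I_s | (u.1 \subset B) && (u.1 != set0))
    multilinear_ext l0 u.1 (a u.2 u.1) x * multilinear_ext l0 (~: u.1) (c u.2 u.1) x.
  move: x; apply: (multilinear_eq mf).
    apply: multilinear_sum => u _; apply: multilinear_mul; exact: multilinear_ext_on.
  move=> l1; pose l : Lam := finfun l1.
  have l1E (g : tensor K n -> K) : tensor_ext g ->
      g (unit_tensor K l1) = g (unit_tensor K l).
    by move=> ge; apply: ge => i k; rewrite /unit_tensor ffunE.
  rewrite (l1E f (multilinear_on_ext mf)).
  have aE (u : {set 'I_d} * 'I_s) : multilinear_ext l0 u.1 (a u.2 u.1) (unit_tensor K l1) =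
      a u.2 u.1 l.
    rewrite l1E; last exact: (multilinear_on_ext (multilinear_ext_on _ _ _)).
    by apply: multilinear_ext_unit => l2 l3 ag; rewrite /a (eq_dmon _ ag).
  have cE (u : {set 'I_d} * 'I_s) : u.1 \subset B ->
      multilinear_ext l0 (~: u.1) (c u.2 u.1) (unit_tensor K l1) = c u.2 u.1 l.
    move=> uB; rewrite l1E; last exact: (multilinear_on_ext (multilinear_ext_on _ _ _)).
    apply: multilinear_ext_unit => l2 l3 ag.
    (* The last block lies outside [A], so the second factor may depend on the slice [l lst]. *)
    have lu : lst \in ~: u.1.
      by rewrite inE; apply/negP => /(subsetP uB); rewrite !inE eqxx.
    rewrite /c (ag lst lu); have [_ h _] := hD (l3 lst).
    congr (_.@[v] / _); apply: h => i; rewrite !inE => /andP[iu _]; apply: ag.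
    by rewrite inE.
  have /eqP : (R l).@[v] = 0 by apply: Rv; apply: codom_f.
  rewrite /R mevalB subr_eq0 mevalM slice_poly_deriv mevalC => /eqP E.
  apply: (mulfI (Dv (l lst))); rewrite E raddf_sum mulr_sumr.
  transitivity (\sum_(A : {set 'I_d} | (A \subset B) && (A != set0)) \sum_(i < s)
       (D (l lst)).1.@[v] *
       (multilinear_ext l0 A (a i A) (unit_tensor K l1) *
        multilinear_ext l0 (~: A) (c i A) (unit_tensor K l1))); last first.
    by rewrite pair_big_dep /=; apply: eq_bigl => u; rewrite andbT.
  apply: eq_bigr => A /andP[sA _]; rewrite raddf_sum; apply: eq_bigr => i _ /=.
  rewrite (aE (A, i)) (cE (A, i)) //= /a /c mevalM mulrCA; congr (_ * _).
  by rewrite mulrC divfK.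
have [|r le_r prr] := @pr_le_sum K d n _ _ _ _ _ fE.
  move=> [A i] /= /andP[sA A0]; exists A, (multilinear_ext l0 A (a i A)),
    (multilinear_ext l0 (~: A) (c i A)).
  split=> //; try exact: multilinear_ext_on.
  apply/eqP => AT; have := subsetP sA lst; rewrite AT !inE eqxx => /(_ isT) //.
exists r => //; apply: leq_trans le_r _.
(* The left factors are indexed by the nonempty subsets of the first [d - 1] blocks. *)
have -> : (2 ^ d.-1 - 1 = #|powerset B :\ set0|)%N.
  have := cardsD1 set0 (powerset B); rewrite inE sub0set card_powerset.
  have -> : #|B| = d.-1 by rewrite cardsC1 card_ord.
  by move=> ->; rewrite add1n subn1.
rewrite [X in (_ <= _ * X)%N](_ : _ = #|[set: 'I_s]|); last by rewrite cardsT card_ord.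
rewrite -cardsX; apply: subset_leq_card.
apply/subsetP => -[A i]; rewrite !inE /= => /andP[sA A0].
by rewrite A0 sA.
Qed.

End PartitionRankBound.

(** * Lower bound on the partition rank *)

(** Gaussian elimination: an equation is either trivial on [Y] or solved for one pivot, and [J]
    consists of the free unknowns. *)
Lemma homogeneous_system (K : fieldType) m r (a : 'I_m -> 'I_r -> K) (Y : {set 'I_m})
    (E : {set 'I_r}) :
  exists J : {set 'I_m}, [/\ J \subset Y, (#|Y| <= #|J| + #|E|)%N &
    forall w : 'I_m -> K, exists y, {in J, y =1 w} /\
      forall k, k \in E -> \sum_(i in Y) y i * a i k = 0].
Proof.
have [c] := ubnP #|E|; elim: c a Y E => // c IH a Y E lt_c.
have [->|[k kE]] := set_0Vmem E.
  exists Y; split; rewrite ?cards0 ?addn0 // => w; exists w; split=> // k.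
  by rewrite inE.
have lt_c' : (#|E :\ k| < c)%N by rewrite (cardsD1 k) kE in lt_c.
have cE : #|E| = #|E :\ k|.+1 by rewrite (cardsD1 k) kE.
have [[l lY alk]|no] := EM (exists2 l, l \in Y & a l k != 0); last first.
  have ak i : i \in Y -> a i k = 0.
    by move=> iY; apply/eqP; apply: contrapT => /negP h; apply: no; exists i.
  have [J [sJ cJ hJ]] := IH a Y (E :\ k) lt_c'.
  exists J; split=> //; first by rewrite cE addnS; apply: leq_trans cJ _.
  move=> w; have [y [yw hy]] := hJ w; exists y; split=> // k' k'E.
  have [->|kk'] := eqVneq k' k; last by apply: hy; rewrite !inE kk'.
  by rewrite big1 // => i iY; rewrite ak ?mulr0.
pose a' i k' := a i k' - a i k / a l k * a l k'.
have [J [sJ cJ hJ]] := IH a' (Y :\ l) (E :\ k) lt_c'.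
exists J; split; first exact: subset_trans sJ (subsetDl _ _).
  by rewrite (cardsD1 l) lY cE addnS add1n ltnS.
move=> w; have [y [yw hy]] := hJ w.
pose yl := - (\sum_(i in Y :\ l) y i * a i k) / a l k.
exists (fun i => if i == l then yl else y i); split=> [i iJ|k' k'E].
  by have := subsetP sJ i iJ; rewrite !inE => /andP[/negbTE -> _]; apply: yw.
rewrite (bigD1 l lY) /= eqxx.
have -> : \sum_(i in Y | i != l) (if i == l then yl else y i) * a i k' =
   \sum_(i in Y :\ l) y i * a i k'.
  apply: eq_big => [i|i /andP[_ /negbTE ->] //]; by rewrite !inE andbC.
have [->|kk'] := eqVneq k' k; first by rewrite /yl divfK // addNr.
rewrite -[RHS](hy k') ?inE ?kk' //.
rewrite [RHS](_ : _ = \sum_(i in Y :\ l) y i * a i k' -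
   (\sum_(i in Y :\ l) y i * a i k) / a l k * a l k').
  by rewrite /yl addrC !mulNr.
rewrite !mulr_suml -sumrB; apply: eq_bigr => i _; rewrite /a'; ring.
Qed.

(** If each piece carried a nonzero relation, the product of these relations would vanish on [S]. *)
Lemma indep_on_cover (K : fieldType) N (S : ('I_N -> K) -> Prop) J (X : finType)
    (C : X -> ('I_N -> K) -> Prop) : (forall v, S v -> exists x, C x v) ->
  indep_on S J -> exists x, indep_on (fun v => S v /\ C x v) J.
Proof.
move=> cov iJ; apply: contrapT => /forallNP no.
have /fin_all_exists[p hp] x : exists p : {mpoly K[N]},
    [/\ p \in mpoly_in J, forall v, S v -> C x v -> p.@[v] = 0 & p != 0].
  apply: contrapT => np; apply: (no x) => p pJ pS.
  apply/eqP; apply: contrapT => /negP p0; apply: np; exists p; split=> // v Sv Cv.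
  exact: pS.
have /eqP : \prod_x p x = 0.
  apply: iJ; first by apply: rpred_prod => x _; have [] := hp x.
  move=> v Sv; have [x Cxv] := cov v Sv; have [_ h _] := hp x.
  by rewrite (bigD1 x) //= mevalM h // mul0r.
by apply/negP/prodf_neq0 => x _; have [] := hp x.
Qed.

Section AnalyticRankBound.
Variables (K : fieldType) (d : nat) (n : 'I_d -> nat).
Hypothesis K_infinite : infinite_type K.
Variable lst : 'I_d.
Hypothesis lstE : val lst = d.-1.
Local Notation N := #|first_coords n|.

Definition block_of (l : 'I_N) : 'I_d := tag (val (enum_val l)).

Definition tensor_of (v : 'I_N -> K) : tensor K n := fun i k =>
  oapp (fun p : first_coords n => v (enum_rank p)) 0
       (insub (Tagged (fun i => 'I_(n i)) k)).

Definition coords_of (x : tensor K n) : 'I_N -> K := fun l =>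
  x (tag (val (enum_val l))) (tagged (val (enum_val l))).

Lemma first_coord_exists i (k : 'I_(n i)) : i != lst ->
  exists p : first_coords n, val p = Tagged (fun i => 'I_(n i)) k.
Proof.
move=> il; have h : (val (tag (Tagged (fun i => 'I_(n i)) k)) < d.-1)%N by rewrite (lt_last lstE).
by exists (exist (fun p : {i : 'I_d & 'I_(n i)} => (val (tag p) < d.-1)%N) _ h).
Qed.

Lemma tensor_ofE v (p : first_coords n) :
  tensor_of v (tagged (val p)) = v (enum_rank p).
Proof.
rewrite /tensor_of; case: p => [[i k] hp] /=.
by rewrite insubT /=; congr (v (enum_rank _)); apply: val_inj.
Qed.

Lemma coords_ofE x (p : first_coords n) : coords_of x (enum_rank p) = x _ (tagged (val p)).
Proof. by rewrite /coords_of enum_rankK. Qed.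

Lemma tensor_of_coords x i (k : 'I_(n i)) : i != lst -> tensor_of (coords_of x) k = x i k.
Proof.
move=> il; have [p E] := first_coord_exists k il.
have := tensor_ofE (coords_of x) p; rewrite coords_ofE E //.
Qed.

Lemma coords_of_tensor v l : coords_of (tensor_of v) l = v l.
Proof. by rewrite /coords_of tensor_ofE enum_valK. Qed.

Variables (r : nat) (q : 'I_r -> tensor K n -> K) (A : 'I_r -> {set 'I_d}).
Hypotheses (A0 : forall k, A k != set0)
  (qA : forall k, multilinear_on (A k) (q k)).

Let low t : {set 'I_d} := [set i : 'I_d | (i < t)%N].
Let Z t (v : 'I_N -> K) := forall k, A k \subset low t -> q k (tensor_of v) = 0.

(* The equations involving block [t] and no later block are linear in block [t], *)
(* so the points solving the first [t + 1] families of equations are fibred in   *)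
(* linear spaces over those solving the first [t].                               *)
Lemma common_zeros_indep t : (t <= d.-1)%N -> exists J : {set 'I_N},
  [/\ J \subset [set l | block_of l \in low t],
      (#|[set l | block_of l \in low t]| <= #|J| + #|[set k | A k \subset low t]|)%N &
      indep_on (Z t) J].
Proof.
elim: t => [_|t IH lt_t].
  have low0 : low 0 = set0 by apply/setP => i; rewrite !inE.
  exists set0; rewrite sub0set; split=> //.
    rewrite [X in #|pred_of_set X|](_ : _ = set0) ?cards0 //.
    by apply/setP => l; rewrite low0 !inE.
  apply: indep_on0; exists (fun=> 0) => k; rewrite low0 subset0.
  by rewrite (negbTE (A0 k)).
have [J [sJ cJ iJ]] := IH (ltnW lt_t).
have td : (t < d)%N by apply: leq_trans lt_t (leq_pred _).
pose tb : 'I_d := Ordinal td.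
have tbl : tb != lst by rewrite -(lt_last lstE).
pose E := [set k | (A k \subset low t.+1) && ~~ (A k \subset low t)].
have lowS i : (i \in low t.+1) = (i == tb) || (i \in low t).
  by rewrite !inE ltnS leq_eqVlt -val_eqE.
have tlow : tb \notin low t by rewrite inE ltnn.
have AE k : A k \subset low t.+1 -> tb \notin A k -> A k \subset low t.
  move=> /subsetP sA tA; apply/subsetP => i iA.
  have := sA i iA; rewrite lowS => /orP[/eqP it|//].
  by rewrite -it iA in tA.
have lowlst i : i \in low t.+1 -> i != lst.
  by rewrite inE -(lt_last lstE) => it; apply: leq_trans lt_t.
pose a v (c : 'I_(n tb)) k := q k (dfwith (tensor_of v) (unit_vector K c)).
pose C (J2 : {set 'I_(n tb)}) v := (n tb <= #|J2| + #|E|)%N /\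
  forall w : 'I_(n tb) -> K, exists y, {in J2, y =1 w} /\
      forall k, k \in E -> \sum_i y i * a v i k = 0.
(* The free unknowns [J2] of the linear system depend on the point [v]; there are finitely many
   choices, so [J] stays independent on the points sharing one of them. *)
have [|J2 iJ2] := indep_on_cover (S := Z t) (J := J) (C := C) _ iJ.
  move=> v _; have [J2 [_ c2 h2]] := homogeneous_system (a v) setT E.
  exists J2; split; first by rewrite cardsT card_ord in c2.
  move=> w; have [y [yw hy]] := h2 w; exists y; split=> // k kE.
  by rewrite -[RHS](hy k kE); apply: eq_bigl => i; rewrite inE.
(* If the count failed for [J2], its piece would be empty and the constant 1 would vanish on it. *)
have c2 : (n tb <= #|J2| + #|E|)%N.
  apply: contrapT => no; have /eqP := iJ2 1 (rpred1 _) (fun v Sv => False_ind _ (no Sv.2.1)).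
  by rewrite oner_eq0.
have /fin_all_exists[cl hcl] (c : 'I_(n tb)) : exists l : 'I_N,
    val (enum_val l) = Tagged (fun i => 'I_(n i)) c.
  by have [p pE] := first_coord_exists c tbl; exists (enum_rank p); rewrite enum_rankK.
have cl_inj : injective cl.
  move=> c c' /(congr1 (fun l => val (enum_val l))); rewrite !hcl; exact: eq_from_Tagged.
have bcl c : block_of (cl c) = tb by rewrite /block_of hcl.
have Xcl l : block_of l = tb -> l \in cl @: setT.
  move=> bl; apply/imsetP; move: bl; rewrite /block_of.
  case El : (val (enum_val l)) => [i c] /= it; subst i; exists c => //.
  by apply: enum_val_inj; apply: val_inj; rewrite hcl.
exists (J :|: cl @: J2); split.
- apply/subsetP => l; rewrite inE => /orP[/(subsetP sJ)|/imsetP[c _ ->]].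
    by rewrite !inE => /ltnW.
  by rewrite inE bcl inE ltnS.
- have dis : [disjoint J & cl @: J2].
    apply/pred0P => l /=; apply/negP => /andP[/(subsetP sJ) + /imsetP[c _ E']].
    by rewrite E' inE bcl (negbTE tlow).
  have -> : #|J :|: cl @: J2| = (#|J| + #|J2|)%N.
    by rewrite cardsU disjoint_setI0 // cards0 subn0 card_imset.
  have -> : #|[set k | A k \subset low t.+1]| = (#|[set k | A k \subset low t]| + #|E|)%N.
    rewrite -(cardsID [set k | A k \subset low t]); congr (_ + _)%N; apply: eq_card => k.
      rewrite !inE; apply: andb_idl => sA; apply: subset_trans sA _.
      by apply/subsetP => i; rewrite lowS => ->; rewrite orbT.
    by rewrite !inE andbC.
  have : (#|[set l | block_of l \in low t.+1]| <=
      #|[set l | block_of l \in low t]| + n tb)%N.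
    have -> : n tb = #|cl @: setT| by rewrite card_imset // cardsT card_ord.
    apply: leq_trans (leq_card_setU _ _); apply: subset_leq_card; apply/subsetP => l.
    rewrite in_set lowS in_setU in_set => /orP[/eqP/Xcl ->|-> //].
    by rewrite orbT.
  move: cJ c2; move: #|J| #|J2| #|E|; lia.
(* The coordinates outside [J] are specialised to those of [z]. Over each [v] of the piece there is
   a solution with the prescribed values on [J2], so the specialised [g] vanishes at [v]. *)
move=> g gJ gZ; apply: (mpoly_vanish K_infinite) => z.
pose gz := subst_mpoly (fun l => if l \in J then 'X_l else (z l)%:MP) g.
have gzE v : gz.@[v] = g.@[fun l => if l \in J then v l else z l].
  rewrite meval_subst_mpoly; apply: meval_eq => l; case: ifP => _.
    by rewrite mevalXU.
  by rewrite mevalC.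
have gz_in : gz \in mpoly_in J.
  apply: subst_mpoly_in => l; case: ifP => [lJ|_]; first exact: mpoly_inX.
  exact: mpoly_inC.
suff gz0 : gz = 0.
  have := gzE z; rewrite gz0 meval0 => h; rewrite h.
  by apply: meval_eq => l; case: ifP.
apply: iJ2 gz_in _ => v [Zv [_ hv]].
have [y [yz hy]] := hv (fun c => z (cl c)).
pose x' : tensor K n := dfwith (tensor_of v) y.
rewrite gzE -(gZ (coords_of x')).
  apply: eq_meval_in gJ _ => l; rewrite inE; case: ifP => [lJ _|_ /= /imsetP[c cJ2 ->]].
    have := subsetP sJ l lJ; rewrite inE => bl.
    rewrite /coords_of /x' dfwith_out; last by apply: contraNneq tlow => ->.
    exact: esym (coords_of_tensor v l).
  by rewrite /coords_of hcl /= /x' dfwith_in yz.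
move=> k sA.
have -> : q k (tensor_of (coords_of x')) = q k x'.
  apply: (qA k).1 => i iA c; apply: tensor_of_coords.
  by apply: lowlst; apply: (subsetP sA).
have [tA|/(AE k sA) sA'] := boolP (tb \in A k); last first.
  rewrite -[RHS](Zv k sA'); apply: (qA k).1 => i iA c; rewrite /x' dfwith_out //.
  by apply: contraNneq tlow => ->; apply: (subsetP sA').
have kE : k \in E.
  by rewrite inE sA; apply: contra tlow => /subsetP; apply.
have qext := multilinear_on_ext (qA k).
rewrite (lin_in_block_expand x' qext ((qA k).2 tb tA)) -[RHS](hy k kE).
apply: eq_bigr => c _; rewrite /x' dfwith_in; congr (_ * _); apply: qext => i c'.
have [it|it] := eqVneq tb i; last by rewrite !dfwith_out.
by subst i; rewrite !dfwith_in.
Qed.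

End AnalyticRankBound.

Lemma analytic_rank_bound (K : fieldType) (d : nat) (n : 'I_d -> nat) (lst : 'I_d)
    (f : tensor K n -> K) r : infinite_type K -> val lst = d.-1 -> pr_le f r ->
  exists2 J, indep_on (ZF f) J & (#|first_coords n| <= #|J| + r)%N.
Proof.
move=> K_infinite lstE [gs [gs1 fE]].
have /fin_all_exists[qA hqA] (k : 'I_r) : exists qA : (tensor K n -> K) * {set 'I_d},
    [/\ qA.2 != set0, lst \notin qA.2, multilinear_on qA.2 qA.1 &
     forall x, qA.1 x = 0 -> gs k x = 0].
  have [_ [A [g [h [A0 AT mg mh E]]]]] := gs1 k.
  have [lA|lA] := boolP (lst \in A); last first.
    by exists (g, A); split=> // x /= gx; rewrite E gx mul0r.
  exists (h, ~: A); split=> //=.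
  - by apply: contraNneq AT => A'; rewrite -(setCK A) A' setC0.
  - by rewrite inE lA.
  - by move=> x hx; rewrite E hx mulr0.
(* With [t = d - 1] all blocks but the last are covered, and all [r] chosen factors count as
   equations. *)
have [|k|J [sJ cJ iJ]] := @common_zeros_indep K d n K_infinite lst lstE r
    (fun k => (qA k).1) (fun k => (qA k).2) _ _ d.-1 (leqnn _).
- by move=> k; have [] := hqA k.
- by have [] := hqA k.
exists J.
  apply: indep_on_sub iJ => v hv u uv; rewrite fE big1 // => k _.
  have [_ lA mq h] := hqA k; apply: h; rewrite -[RHS](hv k); last first.
    apply/subsetP => i iA; rewrite inE (lt_last lstE).
    by apply: contraNneq lA => <-.
  apply: mq.1 => i iA c; have il : i != lst by apply: contraNneq lA => <-.
  have [p pE] := first_coord_exists lstE c il.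
  by have := tensor_ofE v p; have := uv p; rewrite pE /= => -> ->.
apply: leq_trans (leq_trans _ cJ) _.
  apply: (@leq_trans #|[set: 'I_#|first_coords n|]|).
    by rewrite cardsT card_ord.
  apply: subset_leq_card; apply/subsetP => l _; rewrite !inE; exact: valP (enum_val l).
rewrite leq_add2l; apply: leq_trans (max_card _) _; by rewrite card_ord.
Qed.

Theorem theorem4p4
    (K : fieldType) (L : closedFieldType) (iota : {rmorphism K -> L})
    (L_algebraic : forall x : L,
        exists2 p : {poly K}, p != 0 & root (map_poly iota p) x)
    (K_infinite : forall s : seq K, exists x : K, x \notin s)
    (d : nat) (hd : (2 <= d)%N) (n : 'I_d -> nat)
    (f : tensor K n -> K) (hf : multilinear f) :
  exists ar r : nat,
    [/\ is_AR iota f ar, is_PR f r,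
        (ar <= r)%N & (r <= (2 ^ d.-1 - 1) * ar)%N].
Proof.
have ltd : (d.-1 < d)%N by rewrite prednK // ltnW.
pose lst : 'I_d := Ordinal ltd; pose i0 : 'I_d := Ordinal (ltnW hd).
have lstE : val lst = d.-1 by [].
have i0lst : i0 != lst by rewrite -val_eqE /= eq_sym -lt0n -ltnS prednK // ltnW.
have ZF0 : exists v, ZF f v.
  exists (fun=> 0) => u hu.
  rewrite (lin_in_block_expand u (multilinear_on_ext hf) (hf.2 i0 (in_setT _))).
  rewrite big1 // => c _; have [p pE] := first_coord_exists lstE c i0lst.
  by have := hu p; rewrite pE /= => ->; rewrite mul0r.
have [J [iJ Jmax dimJ]] := dim_kclosure iota ZF0.
have [r0 le_r0 pr0] : exists2 r0,
    (r0 <= (2 ^ d.-1 - 1) * (#|first_coords n| - #|J|))%N & pr_le f r0.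
  (* Without any multi-index some block is zero-dimensional; the comparison on basis tensors is then
     vacuous and gives [f = 0], of rank 0. *)
  have [[l0 _]|no] := EM (exists l0 : {dffun forall i : 'I_d, 'I_(n i)}, True).
    exact: (partition_rank_bound hf lstE i0lst l0 iJ Jmax).
  exists 0%N => //; exists (fun _ _ => 0); split=> [[]//|x]; rewrite big_ord0.
  suff all0 l : f (unit_tensor K l) = 0 by apply: (multilinear_eq hf (@multilinear0 K d n) all0 x).
  by case: no; exists (finfun l).
have [|r prr rmin] := @exists_minimizer _ (pr_le f) id; first by exists r0.
exists (#|first_coords n| - #|J|)%N, r; split=> //.
- by exists #|J|.
- have [J' iJ' le_N] := analytic_rank_bound K_infinite lstE prr.
  by rewrite leq_subLR; apply: leq_trans le_N _; rewrite leq_add2r Jmax.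
- exact: leq_trans (rmin _ pr0) le_r0.
Qed.
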